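(* Let $(T_2(t))_{t\ge0}$ be the semigroup on $X_2$ associated with the form $\mathfrak{a}(f,g)=\sum_{j=1}^m\int_0^1\mu_jc_j(x)f_j'(x)\overline{g_j'(x)}\,dx$ with domain $V=\{f\in (H^1(0,1))^m:\exists d\in\mathbb{C}^n \text{ s.t. } (\Phi^+)^\top d=f(0)\text{ and }(\Phi^-)^\top d=f(1)\}$. Then $(T_2(t))_{t\ge0}$ is ultracontractive. In particular, there is a constant $M$ such that $$\|T_2(t)f\|_{X_\infty}\le Mt^{-\frac14}\|f\|_{X_2}\qquad\text{for all }t\in(0,1],\ f\in X_2.$$
   Context: $G$ is a finite connected simple graph (no loops, no multiple edges) with vertices $\mathsf{v}_1,\dots,\mathsf{v}_n$ and edges $\mathsf{e}_1,\dots,\mathsf{e}_m$, in which every vertex has degree at least 2. Each edge is parameterized on $[0,1]$, with endpoints $\mathsf{e}_j(0)$ and $\mathsf{e}_j(1)$. The $n\times m$ matrices $\Phi^{\pm}=(\phi^{\pm}_{ij})$ are: $\phi^+_{ij}=1$ if $\mathsf{e}_j(0)=\mathsf{v}_i$ and $0$ otherwise; $\phi^-_{ij}=1$ if $\mathsf{e}_j(1)=\mathsf{v}_i$ and $0$ otherwise. The constants $\mu_j$ are strictly positive and the coefficients $c_j\in C^1[0,1]$ are strictly positive on $[0,1]$. $X_p:=\prod_{j=1}^mL^p(0,1;\mu_jdx)$ (complex-valued), $X_2$ with inner product $(f,g)_{X_2}=\sum_j\int_0^1f_j\overline{g_j}\mu_jdx$, $\|f\|_{X_\infty}=\max_j\|f_j\|_{L^\infty}$.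 For $f=(f_1,\dots,f_m)^\top$, $f(0)=(f_1(0),\dots,f_m(0))^\top$, $f(1)=(f_1(1),\dots,f_m(1))^\top$. The operator $A$ associated with $\mathfrak{a}$ is $D(A)=\{f\in V:\exists g\in X_2\text{ s.t. }\mathfrak{a}(f,h)=(g,h)_{X_2}\ \forall h\in V\}$, $Af=-g$; it is self-adjoint and dissipative and $(T_2(t))_{t\ge0}$ is the $C_0$-semigroup it generates. Ultracontractive means that $T_2(t)$ maps $X_2$ boundedly into $X_\infty$ for every $t>0$. *)

(* Defs.v *)
From HB Require Import structures.
From mathcomp Require Import all_boot all_order all_algebra.
From mathcomp Require Import complex.
From mathcomp Require Import all_classical all_reals all_analysis.

Set Implicit Arguments.
Unset Strict Implicit.
Unset Printing Implicit Defensive.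

Import Order.TTheory GRing.Theory Num.Theory.
Import numFieldNormedType.Exports.

Local Open Scope ring_scope.

(** Finite graphs with vertex set ['I_n] and edge set ['I_m], each edge [j]
    carrying the orientation of its parameterization: [src j] is the endpoint
    [e_j(0)] and [tgt j] is the endpoint [e_j(1)]. *)

Section Graph.
Context {n m : nat}.
Implicit Types src tgt : 'I_m -> 'I_n.

Definition endpoints src tgt (j : 'I_m) : {set 'I_n} := [set src j; tgt j].

Definition simple_graph src tgt : Prop :=
  (forall j, src j != tgt j) /\ injective (endpoints src tgt).

Definition adjacent_vertices src tgt : rel 'I_n :=
  fun u v => [exists j, endpoints src tgt j == [set u; v]].

Definition connected_graph src tgt : Prop :=
  (0 < n)%N /\ forall u v, connect (adjacent_vertices src tgt) u v.

(* There are no loops, so counting the incident edges gives the degree. *)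
Definition degree src tgt (v : 'I_n) : nat :=
  #|[set j | v \in endpoints src tgt j]|.

Definition incidence_out (R : realType) src : 'M[R[i]]_(n, m) :=
  \matrix_(i, j) (if src j == i then 1 else 0).

Definition incidence_in (R : realType) tgt : 'M[R[i]]_(n, m) :=
  \matrix_(i, j) (if tgt j == i then 1 else 0).

End Graph.

Local Open Scope classical_set_scope.

(** Function spaces are handled through representatives, defined on all of
    [R], of classes of functions on (0,1): what happens outside ]0,1[ is
    invisible to the measures below, and elements are compared almost
    everywhere, so that [X_eq] below is equality in X_p. [R[i]] has no
    measurable or topological structure in the libraries, so measurability,
    integration and continuity of complex-valued functions are taken on real
    and imaginary parts. *)

Section FunctionSpaces.
Context {R : realType}.
Implicit Types (f g u : R -> R[i]) (c phi : R -> R).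

Definition leb01 : {measure set (measurableTypeR R) -> \bar R} :=
  mrestr lebesgue_measure (measurable_itv `]0, 1[%R).

Definition weighted_leb01 (w : {posnum R})
  : {measure set (measurableTypeR R) -> \bar R} :=
  mscale w%:num%:nng leb01.

Definition cintegral (nu : {measure set (measurableTypeR R) -> \bar R}) f
  : R[i] :=
  Complex (\int[nu]_x complex.Re (f x))%R (\int[nu]_x complex.Im (f x))%R.

Definition cLfun (nu : {measure set (measurableTypeR R) -> \bar R})
    (p : \bar R) f : Prop :=
  (fun x => complex.Re (f x)) \in Lfun nu p /\
  (fun x => complex.Im (f x)) \in Lfun nu p.

Definition test_function phi : Prop :=
  [/\ forall x, derivable phi x 1,
      continuous (derive1 phi) &
      exists a b : R, [/\ 0 < a, b < 1 &
        forall x, phi x != 0 -> a <= x <= b]].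

Definition weak_derivative f g : Prop :=
  forall phi, test_function phi ->
    cintegral leb01 (fun x => f x * (derive1 phi x)%:C%C) =
    - cintegral leb01 (fun x => g x * (phi x)%:C%C).

Definition H1 f : Prop :=
  cLfun leb01 2%:E f /\ exists2 g, cLfun leb01 2%:E g & weak_derivative f g.

Definition wderiv f : R -> R[i] :=
  xget (fun _ => 0) [set g | cLfun leb01 2%:E g /\ weak_derivative f g].

(* Elements of H^1(0,1) have a continuous representative on [0,1]; it defines
   their values at 0 and at 1. *)
Definition continuous_rep f : R -> R[i] :=
  xget f [set u : R -> R[i] |
    [/\ {within `[0 : R, 1], continuous (fun x : R => complex.Re (u x))},
        {within `[0 : R, 1], continuous (fun x : R => complex.Im (u x))} &
        {ae leb01, forall x, u x = f x}]].

(* C^1[0,1]: continuous on [0,1] and differentiable in ]0,1[, with a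
   derivative that extends continuously to [0,1]. *)
Definition C1_01 c : Prop :=
  [/\ {within `[0 : R, 1], continuous c},
      forall x, 0 < x < 1 -> derivable c x 1 &
      exists2 dc : R -> R, {within `[0 : R, 1], continuous dc} &
        forall x, 0 < x < 1 -> derive1 c x = dc x].

End FunctionSpaces.

Section Network.
Context {R : realType} {n m : nat}.
Variables (src tgt : 'I_m -> 'I_n) (mu : 'I_m -> {posnum R}).
Variable (c : 'I_m -> R -> R).

Local Notation fam := ('I_m -> R -> R[i]).
Implicit Types (f g h : fam) (T : R -> fam -> fam).

Definition in_X (p : \bar R) f : Prop :=
  forall j, cLfun (weighted_leb01 (mu j)) p (f j).

Definition X_eq f g : Prop :=
  forall j, {ae leb01, forall x, f j x = g j x}.

Definition X2_dot f g : R[i] :=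
  \sum_j cintegral (weighted_leb01 (mu j)) (fun x => f j x * conjc (g j x)).

Definition X2_norm f : R := Num.sqrt (complex.Re (X2_dot f f)).

Definition Xoo_norm f : \bar R :=
  \big[maxe/0%E]_j
    Lnorm (weighted_leb01 (mu j)) +oo%E
      (fun x => (complex.Re `|f j x|)%:E).

Definition bval f (x : R) : 'cV[R[i]]_m := \col_j continuous_rep (f j) x.

Definition form_domain f : Prop :=
  (forall j, H1 (f j)) /\
  exists d : 'cV[R[i]]_n,
    (incidence_out R src)^T *m d = bval f 0 /\
    (incidence_in R tgt)^T *m d = bval f 1.

Definition form_a f g : R[i] :=
  \sum_j cintegral leb01 (fun x =>
    ((mu j)%:num * c j x)%:C%C * wderiv (f j) x * conjc (wderiv (g j) x)).

Definition represents f g : Prop :=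
  in_X 2%:E g /\ forall h, form_domain h -> form_a f h = X2_dot g h.

Definition A_domain f : Prop := form_domain f /\ exists g, represents f g.

Definition op_A f : fam := - xget (fun _ _ => 0) [set g | represents f g].

Definition C0_semigroup T : Prop :=
  (forall t, 0 <= t ->
     [/\ forall f, in_X 2%:E f -> in_X 2%:E (T t f),
         forall (a : R[i]) f g, in_X 2%:E f -> in_X 2%:E g ->
           X_eq (T t (fun j x => a * f j x + g j x))
                (fun j x => a * T t f j x + T t g j x) &
         exists C : R, forall f, in_X 2%:E f ->
           X2_norm (T t f) <= C * X2_norm f]) /\
  [/\ forall f, in_X 2%:E f -> X_eq (T 0 f) f,
      forall s t f, 0 <= s -> 0 <= t -> in_X 2%:E f ->
        X_eq (T (s + t) f) (T s (T t f)) &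
      forall f, in_X 2%:E f -> X2_norm (T t f - f) @[t --> 0^'+] --> (0 : R)].

(* [generator T f g] : f is in the domain of the generator of T, which maps
   f to g. *)
Definition generator T f g : Prop :=
  [/\ in_X 2%:E f, in_X 2%:E g &
      X2_norm (fun j x => (t^-1)%:C%C * (T t f j x - f j x) - g j x)
        @[t --> 0^'+] --> (0 : R)].

Definition semigroup_generated_by_A T : Prop :=
  C0_semigroup T /\
  forall f g, generator T f g <->
    [/\ A_domain f, in_X 2%:E g & X_eq (op_A f) g].

Definition ultracontractive T : Prop :=
  forall t, 0 < t -> exists C : R, forall f, in_X 2%:E f ->
    in_X +oo%E (T t f) /\ (Xoo_norm (T t f) <= (C * X2_norm f)%:E)%E.

End Network.

(* Main.v *)
(* For a C0-semigroup whose generator is symmetric and nonpositive, the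
   quantity [N (T t f) ^ 2 + 2 t a(T t f, T t f)] decreases along the orbit of
   any [f] in the domain; at [t] this bounds the energy by [N f ^ 2 / (2 t)].
   The one-dimensional interpolation inequality
   [|u(x)| <= C (l^(-1/2) ||u|| + l^(1/2) ||u'||)], valid on subintervals of
   length [l], gives the factor [t^(-1/4)] when [l = t^(1/2)], and the bound
   extends from the dense domain to all of X_2.  Local boundedness of the
   semigroup and density of its domain both rest on the completeness of X_2. *)

Require Import Defs.
From HB Require Import structures.
From mathcomp Require Import all_boot all_order all_algebra.
From mathcomp Require Import complex.
From mathcomp Require Import all_classical all_reals all_analysis.
From mathcomp Require Import measurable_realfun ess_sup_inf.
From mathcomp Require Import ring lra.

Set Implicit Arguments.
Unset Strict Implicit.
Unset Printing Implicit Defensive.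

Import Order.TTheory GRing.Theory Num.Theory.
Import numFieldNormedType.Exports.

Local Open Scope classical_set_scope.
Local Open Scope ring_scope.

(** * Semigroups on complete semi-inner product spaces *)

Section primitive.
Context {R : realType}.

(** The semigroup is bounded at each time by an uncontrolled constant, continuous at 0, and linear
    only up to null sets. Vector-valued calculus is therefore replaced by pairings [dot _ z] with
    estimates uniform in [z], turned back into norm bounds by taking [z] to be the vector under
    study. Likewise the energy is not differentiated: its increments are bounded over short steps
    and summed. The vertex conditions enter as the set of admissible [h] in [a(f, h) = (g, h)];
    testing against elements of the generator's domain yields symmetry, sign and energy.
    Interpolation acts on each edge, on real and imaginary parts separately, with [l = s ^+ 2] so
    that no roots appear; the condition [s ^+ 4 <= t] lets one estimate serve small and large times.
    The inequality comes from testing the weak derivative with explicit [C^1] bumps and recovering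
    values at Lebesgue points. *)

Lemma continuous_of_modulus (p : R -> R) (L : R) : 0 <= L ->
  (forall e, 0 < e -> exists2 d, 0 < d & forall s r, 0 <= s <= L -> 0 <= r <= L ->
    `|s - r| <= d -> `|p s - p r| <= e) ->
  continuous (fun s => p (Num.max 0 (Num.min s L))).
Proof.
move=> L0 Hp x; apply/cvgrPdist_le => e e0; have [d d0 Hd] := Hp _ e0.
near=> y; apply: Hd.
- by rewrite le_max lexx/= ge_max L0 ge_min lexx orbT.
- by rewrite le_max lexx/= ge_max L0 ge_min lexx orbT.
have xyd : `|x - y| <= d by near: y; exact: cvgr_dist_le.
apply: le_trans xyd.
have lip u v : u <= v ->
    0 <= Num.max 0 (Num.min v L) - Num.max 0 (Num.min u L) <= v - u.
  move=> uv.
  have : 0 <= Num.min v L - Num.min u L <= v - u.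
    by case: (leP u L) => ?; case: (leP v L) => ?; lra.
  have : Num.min u L <= L by rewrite ge_min lexx orbT.
  by case: (leP 0 (Num.min u L)) => ?; case: (leP 0 (Num.min v L)) => ?; lra.
have [xy|/ltW yx] := leP x y.
  have /andP[? ?] := lip _ _ xy.
  by rewrite distrC [leRHS]distrC !ger0_norm ?subr_ge0// -subr_ge0.
have /andP[? ?] := lip _ _ yx.
by rewrite !ger0_norm ?subr_ge0// -subr_ge0.
Unshelve. all: by end_near. Qed.

(** The conclusion is a mean value inequality, so that later arguments about orbits never mention an
    integral. Clamping the argument to [[0, L]] extends [p] to a function continuous on the whole
    line. *)
Lemma exists_primitive (p : R -> R) (L : R) : 0 <= L ->
  (forall e, 0 < e -> exists2 d, 0 < d & forall s r, 0 <= s <= L -> 0 <= r <= L ->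
    `|s - r| <= d -> `|p s - p r| <= e) ->
  exists P : R -> R, forall a b c w : R, 0 <= a -> a <= b -> b <= L ->
    (forall s : R, a <= s <= b -> `|p s - c| <= w) ->
    `|P b - P a - (b - a) * c| <= (b - a) * w.
Proof.
move=> L0 Hp; pose q s := p (Num.max 0 (Num.min s L)).
have qc : continuous q by exact: continuous_of_modulus.
have iq a b : lebesgue_measure.-integrable `[a, b] (EFin \o q).
  apply: continuous_compact_integrable; first exact: segment_compact.
  exact/continuous_subspaceT.
exists (fun b => (\int[lebesgue_measure]_(x in `[0%R, b]) q x)%R) => a b c w a0 ab bL pcw.
have iqab : lebesgue_measure.-integrable `]a, b] (EFin \o q).
  apply: (integrableS _ _ _ (iq a b)) => //.
  by apply: subset_itv; rewrite bnd_simp.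
have ic r : lebesgue_measure.-integrable `]a, b] (EFin \o (fun=> r : R)).
  apply: (@integrableS _ _ _ lebesgue_measure `[a, b]) => //.
    by apply: subset_itv; rewrite bnd_simp.
  apply: continuous_compact_integrable; first exact: segment_compact.
  by apply/continuous_subspaceT => x; exact: cvg_cst.
rewrite Rintegral_itvB ?bnd_simp//.
have cst r : (\int[lebesgue_measure]_(x in `]a, b]) r)%R = (b - a) * r.
  rewrite Rintegral_cst//= (@lebesgue_measure_itv R `]a, b]%R)/= lte_fin.
  by rewrite mulrC; congr (_ * _); case: ltP => //= ?; lra.
have qcw s : `]a, b]%classic s -> c - w <= q s <= c + w.
  rewrite /= in_itv/= => /andP[a_s sb].
  have -> : q s = p s by rewrite /q min_l ?max_r; lra.
  by rewrite -ler_distl pcw// ltW.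
have : (\int[lebesgue_measure]_(x in `]a, b]) (c - w))%R <= (\int[lebesgue_measure]_(x in `]a, b]) q x)%R.
  by apply: le_Rintegral => // s /qcw/andP[].
have : (\int[lebesgue_measure]_(x in `]a, b]) q x)%R <= (\int[lebesgue_measure]_(x in `]a, b]) (c + w))%R.
  by apply: le_Rintegral => // s /qcw/andP[].
rewrite !cst; move: (Rintegral _ _ _) => I h1 h2; rewrite ler_norml; apply/andP; split; lra.
Qed.

End primitive.

Section semi_inner_product.
Context {R : realType} {V : lmodType R}.

(* [dot x x = 0] is allowed for nonzero [x]: elements of X_2 are functions, not
   classes, and identities below hold up to seminorm 0. *)
Record semi_inner_product (dot : V -> V -> R) : Prop := SemiInnerProduct {
  sipC : forall x y, dot x y = dot y x;
  sipDl : forall x y z, dot (x + y) z = dot x z + dot y z;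
  sipZl : forall a x z, dot (a *: x) z = a * dot x z;
  sip_ge0 : forall x, 0 <= dot x x }.

Variable dot : V -> V -> R.
Hypothesis dotP : semi_inner_product dot.

Let dotC := sipC dotP.
Let dotDl := sipDl dotP.
Let dotZl := sipZl dotP.
Let dot_ge0 := sip_ge0 dotP.

Definition seminorm (x : V) : R := Num.sqrt (dot x x).
Local Notation N := seminorm.

Lemma sipNl x z : dot (- x) z = - dot x z.
Proof. by rewrite -scaleN1r dotZl mulN1r. Qed.

Lemma sipBl x y z : dot (x - y) z = dot x z - dot y z.
Proof. by rewrite dotDl sipNl. Qed.

Lemma sipDr x y z : dot x (y + z) = dot x y + dot x z.
Proof. by rewrite dotC dotDl !(dotC x). Qed.

Lemma sipZr a x z : dot x (a *: z) = a * dot x z.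
Proof. by rewrite dotC dotZl dotC. Qed.

Lemma sipNr x z : dot x (- z) = - dot x z.
Proof. by rewrite dotC sipNl dotC. Qed.

Lemma sip0l z : dot 0 z = 0.
Proof. by rewrite -(scale0r 0) dotZl mul0r. Qed.

Definition sipE :=
  (dotDl, sipDr, dotZl, sipZr, sipNl, sipNr).

Lemma seminorm_ge0 x : 0 <= N x.
Proof. exact: sqrtr_ge0. Qed.
Local Hint Resolve seminorm_ge0 : core.

Lemma sqr_seminorm x : N x ^+ 2 = dot x x.
Proof. by rewrite sqr_sqrtr. Qed.

Lemma seminormZ a x : N (a *: x) = `|a| * N x.
Proof.
by rewrite /N dotZl sipZr mulrA -expr2 sqrtrM ?sqr_ge0// sqrtr_sqr.
Qed.

Lemma seminormN x : N (- x) = N x.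
Proof. by rewrite -scaleN1r seminormZ normrN1 mul1r. Qed.

Lemma seminormC x y : N (x - y) = N (y - x).
Proof. by rewrite -seminormN opprB. Qed.

Lemma seminorm0 : N 0 = 0.
Proof. by rewrite /N sip0l sqrtr0. Qed.

(** Cauchy-Schwarz. Seminorms may vanish on nonzero vectors, so each is first enlarged by [e > 0] to
    allow division, and [e] is then sent to 0. *)
Lemma sip_le_seminorm x y : dot x y <= N x * N y.
Proof.
have [nx ny] := (seminorm_ge0 x, seminorm_ge0 y).
have key e : 0 < e -> dot x y <= (N x + e) * (N y + e).
  move=> e0; set a := N x + e; set b := N y + e.
  have a0 : 0 < a by rewrite /a; lra.
  have b0 : 0 < b by rewrite /b; lra.
  have := dot_ge0 (b *: x - a *: y).
  rewrite !sipE -!sqr_seminorm (dotC y x).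
  have Hx : N x ^+ 2 <= a ^+ 2 by rewrite lerXn2r ?nnegrE//; rewrite /a; lra.
  have Hy : N y ^+ 2 <= b ^+ 2 by rewrite lerXn2r ?nnegrE//; rewrite /b; lra.
  move=> H.
  rewrite -(ler_pM2l (mulr_gt0 a0 b0)).
  have : b ^+ 2 * N x ^+ 2 <= b ^+ 2 * a ^+ 2 by rewrite ler_wpM2l// sqr_ge0.
  have : a ^+ 2 * N y ^+ 2 <= a ^+ 2 * b ^+ 2 by rewrite ler_wpM2l// sqr_ge0.
  nra.
rewrite -subr_ge0; set D := _ - _.
apply/ler_addgt0Pr => e e0.
pose d := Num.min 1 (e / (N x + N y + 1)).
have S0 : 0 < N x + N y + 1 by lra.
have d0 : 0 < d by rewrite lt_min ltr01 divr_gt0.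
have := key _ d0.
have d1 : d <= 1 by rewrite ge_min lexx.
have : d * (N x + N y + 1) <= e.
  by rewrite -ler_pdivlMr// ge_min lexx orbT.
rewrite /D; nra.
Qed.

Lemma normr_sip x y : `|dot x y| <= N x * N y.
Proof.
rewrite ler_norml sip_le_seminorm andbT lerNl -sipNl.
by rewrite (le_trans (sip_le_seminorm _ _))// seminormN.
Qed.

Lemma seminormD x y : N (x + y) <= N x + N y.
Proof.
rewrite -(@ler_pXn2r _ 2)// ?nnegrE ?addr_ge0// sqr_seminorm.
rewrite !sipE (dotC y x) -!sqr_seminorm.
by have := sip_le_seminorm x y; nra.
Qed.

Lemma seminormB x y : N (x - y) <= N x + N y.
Proof. by rewrite -(seminormN y) seminormD. Qed.

Lemma seminorm_triangle y x z : N (x - z) <= N (x - y) + N (y - z).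
Proof. by rewrite (le_trans _ (seminormD _ _))// addrA subrK. Qed.

Lemma seminorm_eqv x y : N (x - y) = 0 -> N x = N y.
Proof.
move=> xy; apply/eqP; rewrite eq_le.
have := seminormD (x - y) y; have := seminormD (y - x) x.
by rewrite !subrK seminormC xy !add0r => -> ->.
Qed.

Lemma sip_eqv x y z : N (x - y) = 0 -> dot x z = dot y z.
Proof.
move=> xy; apply/eqP; rewrite -subr_eq0 -sipBl -normr_le0.
by rewrite (le_trans (normr_sip _ _))// xy mul0r.
Qed.

(** Converts scalar estimates into norm estimates: a bound [dot x z <= a * N z] valid for all [z] is
    used at [z = x]. *)
Lemma seminorm_le_sip x a : 0 <= a ->
  dot x x <= a * N x -> N x <= a.
Proof.
rewrite -sqr_seminorm expr2 => a0.
by have [/ler_pM2r ->//|] := ltP 0 (N x); lra.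
Qed.

(** Only geometrically fast Cauchy sequences are asked to converge; the gliding hump series and the
    Riemann sums below are both of this kind. *)
Definition complete_sip := forall x : nat -> V,
  (forall k, N (x k.+1 - x k) <= 2^-1 ^+ k) ->
  exists l, forall e, 0 < e ->
    exists k0, forall k, (k0 <= k)%N -> N (x k - l) <= e.

Record sip_semigroup (T : R -> V -> V) : Prop := SipSemigroup {
  sg_linear : forall t a x y, 0 <= t ->
    N (T t (a *: x + y) - (a *: T t x + T t y)) = 0;
  sg_bounded : forall t, 0 <= t -> exists C, forall x, N (T t x) <= C * N x;
  sg0 : forall x, N (T 0 x - x) = 0;
  sgD : forall s t x, 0 <= s -> 0 <= t -> N (T (s + t) x - T s (T t x)) = 0;
  sg_continuous : forall x e, 0 < e -> exists2 d, 0 < d &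
    forall t : R, 0 <= t <= d -> N (T t x - x) <= e }.

Definition sg_generator (T : R -> V -> V) (f g : V) : Prop :=
  forall e, 0 < e -> exists2 d, 0 < d &
    forall t : R, 0 < t <= d -> N (t^-1 *: (T t f - f) - g) <= e.

Hypothesis complete : complete_sip.
Variable T : R -> V -> V.
Hypothesis Tsg : sip_semigroup T.

(** Linearity of [T t] holds up to seminorm 0; inside [dot _ z] and [N] it becomes an exact
    equality, so the algebra of the semigroup is done there. *)
Lemma sip_sgP t a x y z : 0 <= t ->
  dot (T t (a *: x + y)) z = a * dot (T t x) z + dot (T t y) z.
Proof.
by move=> t0; rewrite (sip_eqv _ (sg_linear Tsg a x y t0)) !sipE.
Qed.

Lemma seminorm_sgP t a x y : 0 <= t ->
  N (T t (a *: x + y)) = N (a *: T t x + T t y).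
Proof. by move=> t0; apply/seminorm_eqv/(sg_linear Tsg). Qed.

Lemma seminorm_sgZD t a x y : 0 <= t ->
  N (T t (x + a *: y)) = N (T t x + a *: T t y).
Proof. by move=> t0; rewrite addrC seminorm_sgP// addrC. Qed.

Lemma seminorm_sgB t x y : 0 <= t -> N (T t (x - y)) = N (T t x - T t y).
Proof. by move=> t0; rewrite -scaleN1r seminorm_sgZD// scaleN1r. Qed.

Lemma sip_sg0 x z : dot (T 0 x) z = dot x z.
Proof. exact/sip_eqv/(sg0 Tsg). Qed.

Lemma sip_sgD s t x z : 0 <= s -> 0 <= t ->
  dot (T (s + t) x) z = dot (T s (T t x)) z.
Proof. by move=> *; apply/sip_eqv/(sgD Tsg). Qed.

Lemma seminorm_sgD s t x : 0 <= s -> 0 <= t ->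
  N (T (s + t) x) = N (T s (T t x)).
Proof. by move=> *; apply/seminorm_eqv/(sgD Tsg). Qed.

Lemma sg_zero t : 0 <= t -> N (T t 0) = 0.
Proof.
move=> t0; have [C HC] := sg_bounded Tsg t0.
by apply/eqP; rewrite eq_le seminorm_ge0 andbT (le_trans (HC _))// seminorm0// mulr0.
Qed.

Lemma sip_sgZ t a x z : 0 <= t -> dot (T t (a *: x)) z = a * dot (T t x) z.
Proof.
move=> t0; rewrite -[a *: x]addr0 sip_sgP//.
have -> : dot (T t 0) z = 0; last by rewrite addr0.
rewrite -(sip0l z); apply: sip_eqv.
by rewrite subr0 sg_zero.
Qed.

Lemma sip_sg_suml n t (F : 'I_n -> V) z : 0 <= t ->
  dot (T t (\sum_i F i)) z = \sum_i dot (T t (F i)) z.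
Proof.
move=> t0; elim/big_ind2: _ => [|x1 x2 y1 y2 <- <-|//].
  rewrite -(sip0l z); apply: sip_eqv.
  by rewrite subr0 sg_zero.
by rewrite -[x2]scale1r sip_sgP// mul1r scale1r.
Qed.

(** [B] is the operator norm of [T t], a supremum that need not be attained, whence the vector [y]
    reaching two thirds of it. *)
Lemma near_maximizer t L : 0 <= t -> 0 <= L ->
  (exists x, L * N x < N (T t x)) ->
  exists B y, [/\ L <= B, N y <= 1, 2/3 * B <= N (T t y) &
    forall x, N (T t x) <= B * N x].
Proof.
move=> t0 L0 [x0 Lx0]; have [C HC] := sg_bounded Tsg t0.
have C0 : 0 <= C.
  have := HC x0; have := seminorm_ge0 x0; have := seminorm_ge0 (T t x0).
  have := mulr_ge0 L0 (seminorm_ge0 x0); nra.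
pose S := [set N (T t x) | x in [set x | N x <= 1]].
have Sub : has_ubound S.
  exists C => _ [x /= x1 <-]; rewrite (le_trans (HC x))//.
  by rewrite ler_piMr.
have S0 : S !=set0 by exists (N (T t 0)); exists 0 => //=; rewrite seminorm0.
have supP : has_sup S by split.
pose B := sup S.
have HB x : N (T t x) <= B * N x.
  have [x00|xpos] := leP (N x) 0.
    have /eqP x0' : N x == 0 by rewrite eq_le x00 seminorm_ge0.
    by rewrite (le_trans (HC x))// x0' !mulr0.
  rewrite -ler_pdivrMr//; apply: ub_le_sup => //.
  exists ((N x)^-1 *: x) => /=.
    by rewrite seminormZ// ger0_norm ?invr_ge0// mulVf// gt_eqF.
  rewrite -[_ *: x]addr0 seminorm_sgP//.
  rewrite mulrC -[(N x)^-1]ger0_norm ?invr_ge0// -seminormZ//.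
  apply: seminorm_eqv.
  by rewrite addrAC ger0_norm ?invr_ge0// subrr add0r sg_zero.
have x0p : 0 < N x0.
  rewrite lt_neqAle seminorm_ge0 andbT; apply/eqP => x00.
  by have := HC x0; rewrite -x00 mulr0 leNgt (le_lt_trans _ Lx0)// -x00 mulr0.
have LB : L < B.
  by rewrite -(ltr_pM2r x0p) (lt_le_trans Lx0).
have [|_ [y /= y1 <-] yB] := @sup_adherent _ S (B / 3) _ supP.
  by rewrite divr_gt0// (le_lt_trans L0).
exists B, y; split=> //; first exact: ltW.
by apply: ltW; rewrite (le_lt_trans _ yB)// -/B; lra.
Qed.

(* Sokal's gliding hump: if [T (t k)] had norms growing like [k 3^k], a series
   with terms of norm [3^-k] would have an unbounded orbit. *)
Lemma sg_bounded_near0 : exists d K, [/\ 0 < d, 0 <= K &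
  forall (t : R) x, 0 <= t <= d -> N (T t x) <= K * N x].
Proof.
apply: contrapT => Hn.
(* The hump contributes [2/3 * B] and the tail of the series costs at most [B / 2], both scaled by
   [3^-k]; the factor 6 is the inverse of [2/3 - 1/2]. *)
have step (k : nat) : exists p : R * R * V, [/\ 0 <= p.1.1 <= k.+1%:R^-1,
    6 * 3 ^+ k * k%:R <= p.1.2, N p.2 <= 1,
    2/3 * p.1.2 <= N (T p.1.1 p.2) & forall x, N (T p.1.1 x) <= p.1.2 * N x].
  have L0 : 0 <= 6 * 3 ^+ k * k%:R :> R by rewrite !mulr_ge0// exprn_ge0.
  have [t [x [/andP[t0 tk] Lx]]] : exists t x, 0 <= t <= k.+1%:R^-1 /\
      6 * 3 ^+ k * k%:R * N x < N (T t x).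
    apply: contrapT => H; apply: Hn.
    exists k.+1%:R^-1, (6 * 3 ^+ k * k%:R); split=> //.
    move=> t x tk; rewrite leNgt; apply/negP => Lx.
    by apply: H; exists t, x.
  have [B [y [LB y1 By HB]]] := near_maximizer t0 L0 (ex_intro _ x Lx).
  by exists (t, B, y); split=> //=; rewrite t0.
have [p Hp] := choice step.
pose t k := (p k).1.1; pose B k := (p k).1.2; pose y k := (p k).2.
pose hump k x := 3^-1 ^+ k *: y k + x.
pose hump' k x := - 3^-1 ^+ k *: y k + x.
(* The images of [x + w] and [x - w] differ by twice that of [w], so for one of the two signs the
   image is at least as large as that of the hump alone, whatever was accumulated before. *)
pose next k x := if N (T (t k) (hump' k x)) <= N (T (t k) (hump k x))
  then hump k x else hump' k x.
pose x := fix x k := if k is k'.+1 then next k' (x k') else 0.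
have tk0 k : 0 <= t k by have [/andP[]] := Hp k.
have B0 k : 0 <= B k.
  by have [_ H _ _ _] := Hp k; rewrite (le_trans _ H)// !mulr_ge0// exprn_ge0.
have xS k : x k.+1 = next k (x k) by [].
have dist k : N (x k.+1 - x k) <= 3^-1 ^+ k.
  have [_ _ y1 _ _] := Hp k.
  rewrite xS /next /hump /hump'; case: ifP => _; rewrite addrK seminormZ//;
    by rewrite ?normrN ger0_norm ?exprn_ge0 ?invr_ge0// ler_piMr// exprn_ge0// invr_ge0.
have big k : 3^-1 ^+ k * (2/3 * B k) <= N (T (t k) (x k.+1)).
  have [_ _ _ yB _] := Hp k.
  have e0 : 0 <= 3^-1 ^+ k :> R by rewrite exprn_ge0// invr_ge0.
  apply: (@le_trans _ _ (3^-1 ^+ k * N (T (t k) (y k)))).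
    exact: ler_wpM2l.
  have E : 3^-1 ^+ k * N (T (t k) (y k)) *+ 2 <=
      N (T (t k) (hump k (x k))) + N (T (t k) (hump' k (x k))).
    rewrite !seminorm_sgP//; set a := T _ (y k); set b := T _ (x k).
    have <- : N (3^-1 ^+ k *: a) = 3^-1 ^+ k * N a by rewrite seminormZ// ger0_norm.
    rewrite scaleNr; set w := _ *: a.
    have <- : N (2 *: w) = N w *+ 2 by rewrite seminormZ// ger0_norm// mulr_natl.
    rewrite (le_trans _ (seminormB _ _))//.
    by rewrite opprD opprK addrACA subrr addr0 scaler_nat mulr2n.
  move: E; rewrite mulr2n xS /next; case: ifPn => [|/negbTE]; last first.
    move/negP/negP; rewrite -ltNge; lra.
  lra.
have tail k n : N (x (k.+1 + n)%N - x k.+1) <= 3^-1 ^+ k / 2 * (1 - 3^-1 ^+ n).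
  elim: n => [|n IH]; first by rewrite addn0 subrr seminorm0// expr0 subrr mulr0.
  rewrite addnS (le_trans (seminorm_triangle (x (k.+1 + n)%N) _ _))//.
  rewrite (le_trans (lerD (dist _) IH))//.
  by rewrite exprD !exprS; lra.
have [l Hl] : exists l, forall e, 0 < e ->
    exists k0, forall k, (k0 <= k)%N -> N (x k - l) <= e.
  apply: complete => k; rewrite (le_trans (dist k))//.
  by rewrite lerXn2r ?nnegrE ?invr_ge0// lef_pV2 ?posrE//; lra.
have lx k : N (x k.+1 - l) <= 3^-1 ^+ k / 2.
  apply/ler_addgt0Pr => e e0; have [k0 Hk0] := Hl _ e0.
  rewrite (le_trans (seminorm_triangle (x (k.+1 + k0)%N) _ _))//.
  rewrite lerD// ?Hk0 ?leq_addl//.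
  rewrite seminormC// (le_trans (tail _ _))//.
  have : 0 <= 3^-1 ^+ k :> R by rewrite exprn_ge0// invr_ge0.
  have : 0 <= 3^-1 ^+ k0 :> R by rewrite exprn_ge0// invr_ge0.
  nra.
have Tl k : k%:R <= N (T (t k) l).
  have [_ LB _ _ HB] := Hp k.
  have e0 : 0 < 3^-1 ^+ k :> R by rewrite exprn_gt0// invr_gt0.
  have h1 : N (T (t k) (x k.+1)) <= N (T (t k) l) + B k * (3^-1 ^+ k / 2).
    have : N (T (t k) (x k.+1 - l)) <= B k * (3^-1 ^+ k / 2).
      by rewrite (le_trans (HB _))// ler_wpM2l ?B0 ?lx.
    rewrite seminorm_sgB// => H.
    rewrite -lerBlDl (le_trans _ H)// lerBlDl.
    by rewrite (le_trans _ (seminormD _ _))// addrC subrK.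
  have : 3^-1 ^+ k * (6 * 3 ^+ k * k%:R) <= 3^-1 ^+ k * B k.
    by rewrite ler_wpM2l// ltW.
  have -> : 3^-1 ^+ k * (6 * 3 ^+ k * k%:R) = 6 * k%:R :> R.
    rewrite mulrA mulrCA -exprMn mulVf ?pnatr_eq0// expr1n; ring.
  have := big k; lra.
(* Continuity at 0 along the single vector [l] keeps [N (T t l)] below [N l + 1] for small [t],
   whereas [t k] tends to 0 and [N (T (t k) l)] is at least [k]. *)
have [d d0 Hd] := sg_continuous Tsg l ltr01.
have l0 := seminorm_ge0 l.
have [k [dk lk]] : exists k : nat, d^-1 <= k.+1%:R /\ N l + 2 <= k%:R.
  exists (maxn (Num.truncn d^-1) (Num.truncn (N l + 2)).+1); split.
    by rewrite (le_trans (ltW (truncnS_gt _)))// ler_nat ltnS leq_maxl.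
  by rewrite (le_trans (ltW (truncnS_gt _)))// ler_nat leq_maxr.
have := Tl k; rewrite leNgt => /negP; apply.
rewrite (lt_le_trans _ lk)//.
have : N (T (t k) l - l) <= 1.
  apply: Hd; rewrite tk0/=; have [/andP[_ H] _ _ _ _] := Hp k.
  by rewrite (le_trans H)// -[leRHS]invrK lef_pV2 ?posrE ?invr_gt0.
have := seminormD (T (t k) l - l) l; rewrite subrK; lra.
Qed.

Lemma sg_bounded_upto L : exists2 K, 0 <= K &
  forall (t : R) x, 0 <= t <= L -> N (T t x) <= K * N x.
Proof.
have [d [K0 [d0 K00 HK]]] := sg_bounded_near0.
(* A constant at least 1 has monotone powers, so one power covers all shorter times. *)
pose K := 1 + K0; have K1 : 1 <= K by rewrite lerDl.
have [n Ln] : exists n : nat, L <= n%:R * d.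
  exists (Num.truncn (L / d)).+1.
  by rewrite -ler_pdivrMr// ltW// truncnS_gt.
exists (K ^+ n) => [|t x /andP[t0 tL]]; first by rewrite exprn_ge0//; lra.
have {tL Ln} : t <= n%:R * d by exact: le_trans Ln.
elim: n t t0 => [|n IH] t t0.
  rewrite mul0r expr0 mul1r => t0'.
  have -> : t = 0 by apply/eqP; rewrite eq_le t0'.
  by rewrite (seminorm_eqv (sg0 Tsg x)).
have [td _|dt tn] := leP t d.
  apply: (le_trans (HK _ _ _)); rewrite ?t0// ler_wpM2r//.
  have : 1 <= K ^+ n by rewrite exprn_ege1.
  rewrite exprS /K; nra.
have td0 : 0 <= t - d by lra.
rewrite -[t](subrKC d) seminorm_sgD ?(ltW d0)//.
apply: (le_trans (HK _ _ _)); first by rewrite lexx ltW.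
have : N (T (t - d) x) <= K ^+ n * N x.
  by apply: IH => //; rewrite lerBlDr (le_trans tn)// -natr1 mulrDl mul1r.
have := seminorm_ge0 (T (t - d) x).
rewrite exprS /K; nra.
Qed.

Lemma sip_ext x y : (forall z, dot x z = dot y z) -> N x = N y.
Proof. by move=> xy; rewrite /N xy dotC xy. Qed.

Lemma sip_sgDl t x y z : 0 <= t ->
  dot (T t (x + y)) z = dot (T t x) z + dot (T t y) z.
Proof. by move=> t0; rewrite -[x]scale1r sip_sgP// mul1r scale1r. Qed.

Lemma sip_sgN t x z : 0 <= t -> dot (T t (- x)) z = - dot (T t x) z.
Proof. by move=> t0; rewrite -scaleN1r sip_sgZ// mulN1r. Qed.

Definition sip_sgE := (sip_sgDl, sip_sgN, sip_sgZ, dotDl, dotZl, sipNl).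

Lemma sg_addC s t x z : 0 <= s -> 0 <= t ->
  dot (T s (T t x)) z = dot (T t (T s x)) z.
Proof. by move=> s0 t0; rewrite -!sip_sgD// addrC. Qed.

Lemma sg_generator_orbit f g s : 0 <= s ->
  sg_generator T f g -> sg_generator T (T s f) (T s g).
Proof.
move=> s0 fg e e0; have [K K0 HK] := sg_bounded_upto s.
have [|d d0 Hd] := fg (e / (K + 1)); first by rewrite divr_gt0//; lra.
exists d => // t td; have t0 : 0 <= t by case/andP: td => /ltW.
have -> : N (t^-1 *: (T t (T s f) - T s f) - T s g) =
    N (T s (t^-1 *: (T t f - f) - g)).
  by apply: sip_ext => z; rewrite !sip_sgE// sg_addC.
have : N (T s (t^-1 *: (T t f - f) - g)) <= K * N (t^-1 *: (T t f - f) - g).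
  by apply: HK; rewrite s0 lexx.
move/le_trans; apply.
rewrite (le_trans (ler_wpM2l K0 (Hd _ td)))//.
by rewrite mulrCA ler_piMr ?(ltW e0)// ler_pdivrMr//; lra.
Qed.

(** * Decay of the energy along orbits in the domain *)

Section energy.
Hypothesis gen_sym : forall f1 g1 f2 g2,
  sg_generator T f1 g1 -> sg_generator T f2 g2 -> dot g1 f2 = dot g2 f1.
Variables f g : V.
Hypothesis fg : sg_generator T f g.
Let energy s := N (T s f) ^+ 2 - 2 * s * dot (T s g) (T s f).

(* The orbit [u = T s f] satisfies [u' = v := T s g], so that formally
   [energy' = - 4 s N v ^+ 2 <= 0]; all error terms are uniform in [s]. *)
Let energy_step L : exists2 C, 0 <= C & forall e, 0 < e <= 1 ->
  exists2 d, 0 < d & forall s h, 0 <= s -> 0 < h <= d -> s + h <= L ->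
  energy (s + h) - energy s <= h * (C * e).
Proof.
have [K K0 HK] := sg_bounded_upto L.
pose U := K * N f; pose W := K * N g.
have U0 : 0 <= U by rewrite mulr_ge0.
have W0 : 0 <= W by rewrite mulr_ge0.
exists (4 * K * U + 2 * `|L| * (3 * W * K + K ^+ 2)).
  by rewrite addr_ge0 ?mulr_ge0 ?addr_ge0 ?mulr_ge0 ?sqr_ge0.
move=> e /andP[e0 e1].
have [d1 d10 Hd1] := fg e0; have [d2 d20 Hd2] := sg_continuous Tsg g e0.
exists (Num.min d1 d2) => [|s h s0 /andP[h0]]; first by rewrite lt_min d10.
rewrite le_min => /andP[hd1 hd2] shL.
have sL : 0 <= s <= L by rewrite s0/=; lra.
have h0' := ltW h0.
pose u := T s f; pose v := T s g.
pose u' := T (s + h) f; pose v' := T (s + h) g.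
pose d := u' - u; pose w := v' - v; pose r := d - h *: v.
have Nr : N r <= K * (h * e).
  have -> : N r = N (T s (h *: (h^-1 *: (T h f - f) - g))).
    apply: sip_ext => z; rewrite scalerBr scalerA divff ?gt_eqF// scale1r.
    by rewrite /r/d/u/u' !sip_sgE// sip_sgD.
  rewrite (le_trans (HK _ _ sL))// ler_wpM2l// seminormZ gtr0_norm//.
  by rewrite ler_wpM2l// Hd1// h0.
have Nw : N w <= K * e.
  have -> : N w = N (T s (T h g - g)).
    by apply: sip_ext => z; rewrite /w/v/v' !sip_sgE// sip_sgD.
  by rewrite (le_trans (HK _ _ sL))// ler_wpM2l// Hd2// h0'.
have Nu' : N u' <= U by apply: HK; rewrite addr_ge0.
have Nv : N v <= W by exact: HK.
have Edot : d = h *: v + r by rewrite /r addrC subrK.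
(* [g] need not lie in the domain, so [v] may have no derivative. Symmetry rewrites the increment of
   [dot v u] as [dot (v + v') d], in which only the orbit of [f] is differenced. *)
have sym : dot v' u = dot v u'.
  by apply: gen_sym; apply: sg_generator_orbit => //; rewrite addr_ge0.
have b1 : - (K * e * U) <= dot w u'.
  have := normr_sip w u'; rewrite ler_norml => /andP[H _].
  by rewrite (le_trans _ H)// lerN2 ler_pM.
have b2 : dot r u' <= K * (h * e) * U.
  by rewrite (le_trans (sip_le_seminorm _ _))// ler_pM.
have b3 : - (W * (K * (h * e))) <= dot v r.
  have := normr_sip v r; rewrite ler_norml => /andP[H _].
  by rewrite (le_trans _ H)// lerN2 ler_pM.
have b4 : - (K * e * W) <= dot w v.
  have := normr_sip w v; rewrite ler_norml => /andP[H _].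
  by rewrite (le_trans _ H)// lerN2 ler_pM.
have b5 : - (K * e * (K * (h * e))) <= dot w r.
  have := normr_sip w r; rewrite ler_norml => /andP[H _].
  by rewrite (le_trans _ H)// lerN2 ler_pM.
(* Expanding at the right endpoint makes the main term cancel exactly against [2 * h * dot v' u'] in
   the energy, and leaves [- dot d d] with a favourable sign. *)
have E1 : N u' ^+ 2 - N u ^+ 2 = 2 * (h * dot v' u' - h * dot w u' + dot r u') - dot d d.
  rewrite !sqr_seminorm /w /r /d !sipE (dotC u u'); ring.
have E2 : dot v' u' - dot v u =
    2 * (h * dot v v + dot v r) + (h * dot w v + dot w r).
  rewrite /w /r /d !sipE sym; ring.
have E3 : energy (s + h) - energy s = N u' ^+ 2 - N u ^+ 2 - 2 * h * dot v' u'
    - 2 * s * (dot v' u' - dot v u).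
  by rewrite /energy -/u -/v -/u' -/v'; ring.
have dd := dot_ge0 d; have vv := dot_ge0 v.
have low : - (h * e * (3 * W * K + K ^+ 2)) <= dot v' u' - dot v u.
  rewrite E2.
  have : 0 <= h * dot v v by rewrite mulr_ge0.
  have : h * - (K * e * W) <= h * dot w v by rewrite ler_wpM2l.
  have : K ^+ 2 * h * (e * e) <= K ^+ 2 * h * (e * 1).
    by rewrite ler_wpM2l ?ler_wpM2l ?mulr_ge0 ?sqr_ge0// ltW.
  move: b3 b5; lra.
have hw : h * - (K * e * U) <= h * dot w u' by rewrite ler_wpM2l.
have sl : s * - (h * e * (3 * W * K + K ^+ 2)) <= s * (dot v' u' - dot v u).
  by rewrite ler_wpM2l.
have sL' : s * (h * e * (3 * W * K + K ^+ 2)) <= `|L| * (h * e * (3 * W * K + K ^+ 2)).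
  rewrite ler_wpM2r ?mulr_ge0 ?addr_ge0 ?mulr_ge0 ?sqr_ge0 ?(ltW e0)//.
  by rewrite (le_trans _ (ler_norm _))//; case/andP: sL.
rewrite E3 E1; move: b2 hw sl sL'; lra.
Qed.

(** With [t / h] steps of length [h], errors of size [h * C * e'] add up to [t * C * e'], which is
    arbitrarily small. *)
Lemma sg_energy t : 0 <= t ->
  N (T t f) ^+ 2 - 2 * t * dot (T t g) (T t f) <= N f ^+ 2.
Proof.
move=> t0; have [C C0 HC] := energy_step t.
rewrite -/(energy t).
have -> : N f ^+ 2 = energy 0.
  by rewrite /energy mulr0 mul0r subr0 (seminorm_eqv (sg0 Tsg f)).
apply/ler_addgt0Pr => e e0.
pose e' := Num.min 1 (e / (t * C + 1)).
have D0 : 0 < t * C + 1 by rewrite ltr_wpDl// mulr_ge0.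
have e'0 : 0 < e' by rewrite lt_min ltr01 divr_gt0.
have e'1 : e' <= 1 by rewrite ge_min lexx.
have [|d d0 Hd] := HC e'; first by rewrite e'0.
pose n := (Num.truncn (t / d)).+1; pose h := t / n%:R.
have n0 : 0 < n%:R :> R by rewrite ltr0n.
have [t00|tn0] := eqVneq t 0; first by rewrite t00 lerDl ltW.
have h0 : 0 < h by rewrite divr_gt0// lt_neqAle eq_sym tn0.
have hd : h <= d.
  by rewrite ler_pdivrMr// mulrC -ler_pdivrMr// ltW// truncnS_gt.
have nh : n%:R * h = t by rewrite mulrC divfK// gt_eqF.
suff step i : (i <= n)%N -> energy (i%:R * h) <= energy 0 + i%:R * h * (C * e').
  rewrite -nh (le_trans (step _ (leqnn _)))// nh lerD2l.
  have : e' * (t * C + 1) <= e by rewrite -ler_pdivlMr// ge_min lexx orbT.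
  nra.
elim: i => [|i IH] iN; first by rewrite !mul0r addr0.
have := Hd (i%:R * h) h (mulr_ge0 (ler0n _ _) (ltW h0)).
have ih : i%:R * h + h = i.+1%:R * h by rewrite -natr1 mulrDl mul1r.
rewrite h0 hd ih -{1}nh ler_pM2r// ler_nat => /(_ isT iN).
by have := IH (ltnW iN); rewrite -ih; lra.
Qed.
End energy.

(** Continuity at 0 spreads to all times because the increment of the orbit is [T s] applied to
    [T q x - x]. *)
Lemma sg_modulus L K x z s q e : 0 <= K ->
  (forall (t : R) x, 0 <= t <= L -> N (T t x) <= K * N x) ->
  0 <= s -> 0 <= q -> s + q <= L -> N (T q x - x) <= e ->
  `|dot (T (s + q) x) z - dot (T s x) z| <= K * e * N z.
Proof.
move=> K0 HK s0 q0 sq He; rewrite sip_sgD// -sipBl.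
rewrite (le_trans (normr_sip _ _))// ler_wpM2r//.
rewrite -seminorm_sgB//; apply: (le_trans (HK _ _ _)); first by rewrite s0/=; lra.
by rewrite ler_wpM2l.
Qed.

(* The mean of an orbit over [0, h], a limit of Riemann sums, is determined by
   its inner products, hence by primitives of scalar functions. *)
Lemma sg_orbit_integral x h : 0 < h <= 1 -> exists l P, forall z,
  (forall k : R, 0 <= k <= 1 -> dot (T k l) z = P z (k + h) - P z k) /\
  forall a b c w : R, 0 <= a -> a <= b -> b <= 2 ->
    (forall s : R, a <= s <= b -> `|dot (T s x) z - c| <= w) ->
    `|P z b - P z a - (b - a) * c| <= (b - a) * w.
Proof.
(* The bound 2 covers every time [k + h] with [k] and [h] at most 1. *)
move=> /andP[h0 h1]; have [K K0 HK] := sg_bounded_upto 2.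
have modulus s q e z : 0 <= s -> 0 <= q -> s + q <= 2 -> N (T q x - x) <= e ->
    `|dot (T (s + q) x) z - dot (T s x) z| <= K * e * N z.
  exact: sg_modulus.
have prim z : exists P : R -> R, forall a b c w : R, 0 <= a -> a <= b -> b <= 2 ->
    (forall s : R, a <= s <= b -> `|dot (T s x) z - c| <= w) ->
    `|P b - P a - (b - a) * c| <= (b - a) * w.
  apply: exists_primitive => // e e0.
  have D0 : 0 < K * N z + 1 by rewrite ltr_wpDl// mulr_ge0.
  have [|d d0 Hd] := sg_continuous Tsg x (e := e / (K * N z + 1)).
    by rewrite divr_gt0.
  exists d => // s r /andP[s0 s2] /andP[r0 r2] srd.
  have Ke : K * (e / (K * N z + 1)) * N z <= e.
    by rewrite mulrAC mulrA -mulrA mulrCA ler_piMr ?(ltW e0)// ler_pdivrMr// mul1r lerDl.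
  apply: (le_trans _ Ke); have [sr|/ltW rs] := leP s r.
    rewrite distrC -[r](subrKC s); apply: modulus; rewrite ?subr_ge0 ?subrKC//.
    by apply: Hd; rewrite subr_ge0 sr/= -[_ - _]ger0_norm ?subr_ge0// distrC.
  rewrite -[s](subrKC r); apply: modulus; rewrite ?subr_ge0 ?subrKC//.
  by apply: Hd; rewrite subr_ge0 rs/= -[_ - _]ger0_norm ?subr_ge0.
have [P HP] := choice prim.
pose c n : R := h / n.+1%:R.
pose S n := c n *: \sum_(i < n.+1) T (i%:R * c n) x.
have c0 n : 0 < c n by rewrite divr_gt0.
have nc n : n.+1%:R * c n = h by rewrite mulrC divfK.
(* The error is proportional to [N z], with a factor independent of [z]; this uniformity gives
   convergence of the Riemann sums in norm, not merely weakly. *)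
have riemann n e k z : 0 <= k <= 1 ->
    (forall q : R, 0 <= q <= c n -> N (T q x - x) <= e) ->
    `|dot (T k (S n)) z - (P z (k + h) - P z k)| <= h * (K * e * N z).
  move=> /andP[k0 k1] He.
  suff part j : (j <= n.+1)%N ->
      `|c n * (\sum_(i < j) dot (T (k + i%:R * c n) x) z) -
        (P z (k + j%:R * c n) - P z k)| <= j%:R * c n * (K * e * N z).
    have := part _ (leqnn n.+1); rewrite nc sip_sgZ// sip_sg_suml//.
    by under [X in _ -> `|_ * X - _| <= _]eq_bigr do rewrite -sip_sgD ?mulr_ge0// ?ltW//.
  elim: j => [_|j IH jn].
    by rewrite big_ord0 mulr0 !mul0r addr0 !subrr normr0.
  rewrite big_ord_recr/= mulrDr.
  have jn1 : j%:R * c n + c n <= h.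
    have -> : j%:R * c n + c n = j.+1%:R * c n by rewrite -natr1 mulrDl mul1r.
    by rewrite -(nc n) ler_pM2r// ler_nat.
  have jc0 : 0 <= j%:R * c n by rewrite mulr_ge0// ltW.
  have := IH (ltnW jn).
  have : `|P z (k + (j%:R * c n + c n)) - P z (k + j%:R * c n)
      - (k + (j%:R * c n + c n) - (k + j%:R * c n)) * dot (T (k + j%:R * c n) x) z|
      <= (k + (j%:R * c n + c n) - (k + j%:R * c n)) * (K * e * N z).
    apply: HP.
    - by rewrite addr_ge0.
    - by rewrite lerD2l lerDl ltW.
    - by have := c0 n; lra.
    move=> s /andP[s1 s2]; rewrite -[s](subrKC (k + j%:R * c n)).
    by apply: modulus; [lra|lra|lra|apply: He; lra].
  have -> : k + (j%:R * c n + c n) - (k + j%:R * c n) = c n by ring.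
  have -> : j%:R * c n + c n = j.+1%:R * c n by rewrite -natr1 mulrDl mul1r.
  rewrite -natr1 !mulrDl !mul1r !ler_norml => /andP[? ?] /andP[? ?].
  by apply/andP; split; lra.
(* The denominator absorbs the factor [h * K] and leaves half of [2^-j], so that two consecutive
   sums differ by at most [2^-j]. *)
have mesh j : exists n, forall q : R, 0 <= q <= c n ->
    N (T q x - x) <= 2^-1 ^+ j / (2 * (K + 1)).
  have [|d d0 Hd] := sg_continuous Tsg x (e := 2^-1 ^+ j / (2 * (K + 1))).
    by rewrite divr_gt0 ?exprn_gt0 ?invr_gt0//; lra.
  exists (Num.truncn (h / d)) => q /andP[q0 qc]; apply: Hd.
  rewrite q0 (le_trans qc)// /c ler_pdivrMr// mulrC -ler_pdivrMr//.
  by rewrite ltW// truncnS_gt.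
have [n Hn] := choice mesh.
have err j k z : 0 <= k <= 1 ->
    `|dot (T k (S (n j))) z - (P z (k + h) - P z k)| <= 2^-1 ^+ j / 2 * N z.
  move=> k01; rewrite (le_trans (riemann _ _ _ z k01 (Hn j)))// mulrA ler_wpM2r//.
  rewrite mulrA mulrCA ler_wpM2l ?exprn_ge0 ?invr_ge0//.
  have -> : h * K / (2 * (K + 1)) = 2^-1 * (h * K / (K + 1)).
    by field; lra.
  rewrite ler_piMr ?invr_ge0// ler_pdivrMr//; last lra.
  by rewrite mul1r (le_trans (_ : _ <= 1 * K)) ?ler_wpM2r// mul1r lerDl.
have [|l Hl] := @complete (fun j => S (n j)).
  move=> j; apply: seminorm_le_sip; first by rewrite exprn_ge0 ?invr_ge0.
  set z := _ - _; rewrite {1}/z sipBl.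
  have k0 : 0 <= (0 : R) <= 1 by rewrite lexx ler01.
  have := err j 0 z k0; have := err j.+1 0 z k0.
  rewrite !sip_sg0 !ler_norml => /andP[_ +] /andP[+ _].
  rewrite exprS; have : 0 <= 2^-1 ^+ j * N z by rewrite mulr_ge0// exprn_ge0 ?invr_ge0.
  lra.
exists l, P => z; split => [k k01|]; last exact: HP.
apply/eqP; rewrite -subr_eq0 -normr_le0; apply/ler_addgt0Pr => e e0; rewrite add0r.
have e'0 : 0 < e / (2 * (K * N z + 1)).
  by rewrite divr_gt0// mulr_gt0// ltr_wpDl// mulr_ge0.
have e''0 : 0 < e / (N z + 1) by rewrite divr_gt0// ltr_wpDl.
have [j0 Hj0] := Hl _ e'0.
have [j [jj0 je]] : exists j, (j0 <= j)%N /\ 2^-1 ^+ j <= e / (N z + 1).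
  pose j1 := (Num.truncn ((e / (N z + 1))^-1)).+1.
  exists (maxn j0 j1); split; first exact: leq_maxl.
  apply: (@le_trans _ _ (2^-1 ^+ j1)).
    by rewrite ler_wiXn2l ?leq_maxr ?invr_ge0// invf_le1// ler1n.
  rewrite -[leRHS]invrK exprVn lef_pV2 ?posrE ?invr_gt0 ?exprn_gt0//.
  rewrite (le_trans (ltW (truncnS_gt _)))// -natrX ler_nat.
  by rewrite ltnW// ltn_expl.
have A1 : `|dot (T k l) z - dot (T k (S (n j))) z| <= e / 2.
  rewrite -sipBl (le_trans (normr_sip _ _))//.
  have k0 : 0 <= k by case/andP: k01.
  rewrite -seminorm_sgB// (@le_trans _ _ (K * (e / (2 * (K * N z + 1))) * N z))//.
    rewrite ler_wpM2r//; apply: (le_trans (HK _ _ _)).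
      by rewrite k0/=; case/andP: k01; lra.
    by rewrite ler_wpM2l// seminormC Hj0.
  have -> : K * (e / (2 * (K * N z + 1))) * N z = e / 2 * (K * N z / (K * N z + 1)).
    by field; have : 0 <= K * N z by [rewrite mulr_ge0]; lra.
  rewrite ler_piMr ?divr_ge0 ?(ltW e0)// ler_pdivrMr ?mul1r ?lerDl//.
  by rewrite ltr_wpDl// mulr_ge0.
have A2 : 2^-1 ^+ j / 2 * N z <= e / 2.
  have : 2^-1 ^+ j * N z <= e / (N z + 1) * N z by rewrite ler_wpM2r.
  have : e / (N z + 1) * N z <= e.
    rewrite mulrAC -mulrA ler_piMr ?(ltW e0)// ler_pdivrMr ?ltr_wpDl//.
    by rewrite mul1r lerDl.
  lra.
have := err j k z k01; move: A1; rewrite !ler_norml => /andP[? ?] /andP[? ?].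
by apply/andP; split; lra.
Qed.

(** The classical regularization: [v] is the average of the orbit over [[0, h]], the generator sends
    it to [(T h x - x) / h], and it tends to [x] as [h] tends to 0. All limits are read off the
    primitives [P z]. *)
Lemma sg_generator_dense x e : 0 < e ->
  exists v g, sg_generator T v g /\ N (v - x) <= e.
Proof.
move=> e0; have [d d0 Hd] := sg_continuous Tsg x e0.
pose h := Num.min 1 d.
have h0 : 0 < h by rewrite lt_min ltr01.
have h1 : h <= 1 by rewrite ge_min lexx.
have hd : h <= d by rewrite ge_min lexx orbT.
have [|l [P HP]] := @sg_orbit_integral x h; first by rewrite h0.
have [K K0 HK] := sg_bounded_upto 2.
have h0' : 0 <= h by exact: ltW.
exists (h^-1 *: l), (h^-1 *: (T h x - x)); split; last first.
  apply: seminorm_le_sip; first exact: ltW.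
  set z := _ - _; have [Hl Hb] := HP z.
  rewrite {1}/z sipBl dotZl -sip_sg0 Hl ?lexx ?ler01// add0r.
  have : `|P z h - P z 0 - (h - 0) * dot x z| <= (h - 0) * (e * N z).
    apply: Hb => //; first lra.
    move=> s /andP[s0 sh]; rewrite -sipBl (le_trans (normr_sip _ _))//.
    by rewrite ler_wpM2r// Hd// s0 (le_trans sh).
  rewrite subr0 ler_norml => /andP[_].
  set A := _ - P z 0; set B := dot x z => AB; rewrite -(ler_pM2l h0).
  by have -> : h * (h^-1 * A - B) = A - h * B by field; rewrite gt_eqF.
move=> e1 e10.
(* With this tolerance [w], the increment of [P z] near time [h] costs [K * w] and the one near time
   0 costs [w], for a total of [e1 * h]. *)
have e20 : 0 < e1 * h / (K + 1) by rewrite divr_gt0 ?mulr_gt0//; lra.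
have [d1 d10 Hd1] := sg_continuous Tsg x e20.
exists (Num.min 1 d1) => [|t /andP[t0]]; first by rewrite lt_min ltr01.
rewrite le_min => /andP[t1 td1]; have t0' := ltW t0.
apply: seminorm_le_sip; first exact: ltW.
set z := _ - _; have [Hl Hb] := HP z.
rewrite {1}/z sipBl dotZl sipBl sip_sgZ// !(dotZl h^-1) Hl ?t0'//.
have -> : dot l z = P z (0 + h) - P z 0.
  by rewrite -Hl ?lexx ?ler01// sip_sg0.
rewrite sipBl add0r.
have B1 : `|P z (t + h) - P z h - (t + h - h) * dot (T h x) z| <=
    (t + h - h) * (K * (e1 * h / (K + 1)) * N z).
  apply: Hb; rewrite ?lerDr//; first lra.
  move=> s /andP[s1 s2]; rewrite -[s](subrKC h).
  by apply: (sg_modulus z K0 HK); [exact: h0'|lra|lra|apply: Hd1; lra].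
have B2 : `|P z t - P z 0 - (t - 0) * dot x z| <= (t - 0) * (e1 * h / (K + 1) * N z).
  apply: Hb => //; first lra.
  move=> s /andP[s0 st]; rewrite -sipBl (le_trans (normr_sip _ _))//.
  by rewrite ler_wpM2r// Hd1// s0 (le_trans st).
have := e20; move: B1 B2; rewrite addrK subr0 !ler_norml.
set w := e1 * h / (K + 1) => /andP[_ B1] /andP[B2 _] w0.
have wE : (K + 1) * w = e1 * h by rewrite /w mulrC divfK// gt_eqF//; lra.
rewrite -(ler_pM2l (mulr_gt0 t0 h0)).
set A := dot (T h x) z in B1 *; set B := dot x z in B2 *.
have -> : t * h * (t^-1 * (h^-1 * (P z (t + h) - P z t) - h^-1 * (P z h - P z 0)) -
    h^-1 * (A - B)) = P z (t + h) - P z t - (P z h - P z 0) - t * (A - B).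
  by field; rewrite !gt_eqF.
have -> : t * h * (e1 * N z) = t * ((K + 1) * w) * N z by rewrite wE; ring.
move: B1 B2; lra.
Qed.

End semi_inner_product.

(** * Completeness of L^2 *)

Section riesz_fischer.
Context d {T : measurableType d} {R : realType}.
Variable nu : {measure set T -> \bar R}.

(** Each step satisfies [2 |a| <= 2^-k + 2^k a^2], so a weighted sum of squares controls the sum of
    absolute values. *)
Lemma cvgn_of_summable_steps (u : nat -> R) (A : R) :
  (forall n, \sum_(0 <= k < n) 2 ^+ k * (u k.+1 - u k) ^+ 2 <= A) -> cvgn u.
Proof.
move=> HA.
have : cvgn (series (telescope u)).
  apply: normed_cvg; apply: nondecreasing_is_cvgn.
    by apply: nondecreasing_series => n _ _; exact: normr_ge0.
  exists (1 + A / 2) => _ [n _ <-]; rewrite /series /=.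
  apply: (@le_trans _ _ (\sum_(0 <= k < n) (2^-1 ^+ k + 2 ^+ k * (u k.+1 - u k) ^+ 2) / 2)).
    apply: ler_sum => k _; rewrite /telescope.
    have k0 : 0 < 2 ^+ k :> R by rewrite exprn_gt0.
    rewrite exprVn -(ler_pM2l k0) -[(_ - _) ^+ 2]real_normK ?num_real//.
    set a := `|_|; have : 0 <= (2 ^+ k * a - 1) ^+ 2 by rewrite sqr_ge0.
    have -> : 2 ^+ k * ((2 ^- k + 2 ^+ k * a ^+ 2) / 2) =
      (1 + (2 ^+ k * a) ^+ 2) / 2 by field; rewrite gt_eqF.
    by nra.
  rewrite -mulr_suml big_split/= mulrDl lerD//; last by rewrite ler_wpM2r// invr_ge0.
  have -> : \sum_(0 <= i < n) 2^-1 ^+ i = 2 * (1 - 2^-1 ^+ n) :> R.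
    elim: n => [|n IH]; first by rewrite big_nil expr0 subrr mulr0.
    by rewrite big_nat_recr//= IH exprS; lra.
  have : 0 <= 2^-1 ^+ n :> R by rewrite exprn_ge0// invr_ge0.
  by lra.
rewrite telescopeK => H.
have -> : u = (fun n => (u n - u 0%N) + u 0%N) by apply/funext => n; rewrite subrK.
by apply: is_cvgD => //; exact: is_cvg_cst.
Qed.

Lemma riesz_fischer (u : nat -> T -> R) (C : R) :
  (forall k, measurable_fun setT (u k)) ->
  (forall k m, (k <= m)%N ->
    (\int[nu]_x ((u m x - u k x) ^+ 2)%:E <= (C * 4^-1 ^+ k)%:E)%E) ->
  exists2 l : T -> R, measurable_fun setT l &
    forall k, (\int[nu]_x ((u k x - l x) ^+ 2)%:E <= (C * 4^-1 ^+ k)%:E)%E.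
Proof.
move=> mu Hu.
(* The weight [2 ^+ k] still leaves integrals of order [2^-k], so the series [G] is integrable,
   hence finite almost everywhere. *)
pose g (k : nat) (x : T) := (2 ^+ k * (u k.+1 x - u k x) ^+ 2)%:E.
have g0 k x : (0 <= g k x)%E by rewrite lee_fin mulr_ge0 ?sqr_ge0// exprn_ge0.
have mg k : measurable_fun setT (g k).
  apply/measurable_EFinP/measurable_funM => //.
  by apply: measurable_funX; exact: measurable_funB.
pose G x := (\sum_(k <oo) g k x)%E.
have mG : measurable_fun setT G.
  by apply: (@ge0_emeasurable_sum _ _ _ _ _ xpredT).
have iG : nu.-integrable setT G.
  apply/integrableP; split => //.
  under eq_integral => x _ do rewrite gee0_abs ?nneseries_ge0//.
  rewrite integral_nneseries//.
  apply: (@le_lt_trans _ _ (\sum_(k <oo) ((`|C| * 2^-1 ^+ k)%:E))%E).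
    apply: lee_nneseries => [k _ _|k _].
      exact: integral_ge0.
    rewrite /g; under eq_integral => x _ do rewrite EFinM.
    rewrite ge0_integralZl//; last 2 first.
    - apply/measurable_EFinP/measurable_funX; exact: measurable_funB.
    - by move=> x _; rewrite lee_fin sqr_ge0.
    apply: (@le_trans _ _ ((2 ^+ k)%:E * (`|C| * 4^-1 ^+ k)%:E)%E).
      apply: lee_wpmul2l; first by rewrite lee_fin exprn_ge0.
      rewrite (le_trans (Hu _ _ (leqnSn k)))// lee_fin ler_wpM2r ?ler_norm//.
    rewrite -EFinM lee_fin mulrCA ler_wpM2l// -exprMn.
    by rewrite (_ : 2 * 4^-1 = 2^-1 :> R)//; field.
  have E k : (`|C| * 2^-1 ^+ k)%:E = ((2 * `|C|) / (2 ^ (k + 0.+1))%:R)%:E.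
    congr EFin.
    by rewrite addn1 expnS natrM natrX invfM exprVn mulrA [2 * _]mulrC mulfK.
  under eq_eseriesr do rewrite E.
  have /cvg_lim H := @cvg_geometric_eseries_half R (2 * `|C|) 0.
  by rewrite (H _)//; exact: ltry.
pose D := [set x | (G x < +oo)%E].
have mD : measurable D.
  by rewrite -[D]setTI; exact: emeasurable_fun_infty_o.
have D0 : {ae nu, forall x, D x}.
  apply: filterS (integrable_ae measurableT iG) => x /(_ Logic.I).
  by rewrite ge0_fin_numE// nneseries_ge0.
pose v k := u k \_ D.
have mv k : measurable_fun setT (v k).
  by apply/(measurable_restrictT (u k) mD); exact: measurable_funTS.
have cv x : cvgn (v^~ x).
  have [xD|xD] := pselect (D x); last first.
    have -> : v^~ x = cst 0 by apply/funext => k; rewrite /v patchC// inE.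
    exact: is_cvg_cst.
  have -> : v^~ x = u^~ x by apply/funext => k; rewrite /v patchT// inE.
  apply: (@cvgn_of_summable_steps _ (fine (G x))) => n.
  rewrite -lee_fin fineK ?ge0_fin_numE ?nneseries_ge0// -sumEFin.
  by apply: (@nneseries_lim_ge R (g^~ x) xpredT 0 n) => *; exact: g0.
exists (fun x => limn (v^~ x)).
  by apply: (measurable_fun_cvg mv) => x _; exact: cv.
move=> k.
(* Fatou along the tail transfers the bound between [u k] and later terms to the limit, with the
   same constant. *)
pose f m x := ((u k x - v (k + m)%N x) ^+ 2)%:E.
have mf m : measurable_fun setT (f m).
  by apply/measurable_EFinP/measurable_funX; exact: measurable_funB.
have f0 m x : setT x -> (0 <= f m x)%E by rewrite lee_fin sqr_ge0.
have fE x : limn_einf (f^~ x) = ((u k x - limn (v^~ x)) ^+ 2)%:E.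
  suff /cvg_limn_einf_sup[] : f^~ x @ \oo --> ((u k x - limn (v^~ x)) ^+ 2)%:E by [].
  apply: cvg_EFin; first exact: nearW.
  rewrite /f/=; under eq_fun do rewrite expr2; rewrite expr2.
  have : u k x - v (k + m)%N x @[m --> \oo] --> u k x - limn (v^~ x).
    apply: cvgB; first exact: cvg_cst.
    exact: (cvg_comp (addn k) (v^~ x) (cvg_addnl k) (cv x)).
  by move=> H; exact: cvgM.
under eq_integral => x _ do rewrite -fE.
apply: (@le_trans _ _ (limn_einf (fun n => \int[nu]_x f n x))%E).
  exact: fatou.
rewrite limn_einf_lim; apply: lime_le; first exact: is_cvg_einfs.
apply: nearW => m; apply: (@le_trans _ _ (\int[nu]_x f m x)%E).
  by apply: ereal_inf_lbound; exists m => /=.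
apply: (@le_trans _ _ (\int[nu]_x ((u (k + m)%N x - u k x) ^+ 2)%:E)%E); last first.
  exact/Hu/leq_addr.
apply: ae_ge0_le_integral => //.
- exact: f0.
- by move=> x _; rewrite lee_fin sqr_ge0.
- by apply/measurable_EFinP/measurable_funX; exact: measurable_funB.
apply: filterS D0 => x xD _.
by rewrite /f /v patchT ?inE// lee_fin -sqrrN opprB.
Qed.
End riesz_fischer.

(** * Interpolation inequality for weakly differentiable functions *)

Section restricted_measure.
Context d {T : measurableType d} {R : realType}.
Variables (mu : {measure set T -> \bar R}) (D : set T) (mD : measurable D).

Import HBNNSimple.

(* No measurability is assumed: the coefficients of the form are arbitrary
   functions outside [[0, 1]]. *)
Lemma ge0_integral_mrestr (f : T -> \bar R) : (forall x, 0 <= f x)%E ->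
  (\int[mrestr mu mD]_x f x = \int[mu]_(x in D) f x)%E.
Proof.
move=> f0; rewrite ge0_integralTE// ge0_integralE//.
apply/eqP; rewrite eq_le; apply/andP; split;
  apply/ge_ereal_sup => _ [h /= hf <-]; apply: ereal_sup_ubound => /=.
  exists (proj_nnsfun h mD) => [x|].
    rewrite /= mindicE /patch; case: ifPn => [xD|xD].
      by rewrite mulr1.
    by rewrite mulr0.
  rewrite !sintegralET; apply: eq_fsbigr => r _.
  have [->|r0] := eqVneq r 0; first by rewrite !mul0e.
  congr (_ * _)%E; rewrite /mrestr; congr (mu _); apply/seteqP; split => x /=.
    rewrite mindicE; have [xD|xD] := boolP (x \in D).
      by rewrite mulr1; split=> //; exact: set_mem.
    by rewrite mulr0 => r0'; rewrite r0' eqxx in r0.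
  by move=> [hx xD]; rewrite mindicE mem_set// mulr1.
exists h => [x|].
  by rewrite (le_trans (hf x))// /patch; case: ifP.
rewrite !sintegralET; apply: eq_fsbigr => r _.
have [->|r0] := eqVneq r 0; first by rewrite !mul0e.
congr (_ * _)%E; rewrite /mrestr; congr (mu _); apply/seteqP; split => [x [] //|x /= hx].
split => //; apply: contrapT => xD.
have := hf x; rewrite patchN ?notin_setE// hx lee_fin => r0'.
have : 0 <= h x by exact: fun_ge0.
rewrite hx => r0''.
by move/eqP: r0; apply; apply/eqP; rewrite eq_le r0'.
Qed.

Lemma integral_mrestr (f : T -> \bar R) :
  (\int[mrestr mu mD]_x f x = \int[mu]_(x in D) f x)%E.
Proof. by rewrite [LHS]integralE [RHS]integralE !ge0_integral_mrestr. Qed.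

End restricted_measure.

(** * Steps of class [C^1] with piecewise linear derivative *)

Section smooth_step.
Context {R : realType}.
Implicit Types x e s a : R.

Definition sqr_ramp s : R := Num.max 0 s ^+ 2 / 2.

(** A second difference of the ramp: the hat function centred at [x], of half-width [e] and height
    [1 / e]. Its antiderivative [smooth_step] is the same second difference of [sqr_ramp]; the
    shifts are written [s + a] so that one derivative computation serves all three terms. *)
Definition tent x e s : R :=
  (Num.max 0 (s + (e - x)) - 2 * Num.max 0 (s + (- x)) + Num.max 0 (s + (- e - x))) / e ^+ 2.

Definition smooth_step x e s : R :=
  (sqr_ramp (s + (e - x)) - 2 * sqr_ramp (s + (- x)) + sqr_ramp (s + (- e - x))) / e ^+ 2.

Lemma is_derive_sqr_ramp a s :
  is_derive s (1 : R) (fun s => sqr_ramp (s + a)) (Num.max 0 (s + a)).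
Proof.
have lim : h^-1 *: (sqr_ramp (h *: (1 : R) + s + a) - sqr_ramp (s + a))
    @[h --> 0^'] --> Num.max 0 (s + a).
  apply/cvgrPdist_le => e e0; near=> h.
  have h0 : h != 0 by near: h; exact: nbhs_dnbhs_neq.
  have he : `|h| <= e.
    by near: h; apply: (@dnbhs0_le _ _ e e0).
  apply: le_trans he; rewrite -[_ *: _]/(_ * _) -[h *: 1]/(h * 1) mulr1.
   set t := s + a; rewrite -addrA -/t.
  have -> : Num.max 0 t - h^-1 * (sqr_ramp (h + t) - sqr_ramp t) =
      h^-1 * (h * Num.max 0 t - (sqr_ramp (h + t) - sqr_ramp t)) by field.
  rewrite normrM normfV ler_pdivrMl ?normr_gt0// -normrM -expr2 [`|h ^+ 2|]ger0_norm ?sqr_ge0//.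
  rewrite /sqr_ramp ler_norml.
  by case: (leP 0 t) => ?; case: (leP 0 (h + t)) => ?; apply/andP; split; nra.
apply: DeriveDef; last exact/cvg_lim.
by apply/cvg_ex; exists (Num.max 0 (s + a)).
Unshelve. all: by end_near. Qed.

Global Instance is_derive_smooth_step x e s :
  is_derive s (1 : R) (smooth_step x e) (tent x e s).
Proof.
have H1 := is_derive_sqr_ramp (e - x) s; have H2 := is_derive_sqr_ramp (- x) s.
have H3 := is_derive_sqr_ramp (- e - x) s.
have -> : smooth_step x e = (e ^- 2) \*: ((fun s => sqr_ramp (s + (e - x))) -
    (2 : R) \*: (fun s => sqr_ramp (s + (- x))) + (fun s => sqr_ramp (s + (- e - x)))).
  by apply/funext => y; rewrite /smooth_step mulrC.
rewrite /tent mulrC.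
exact: (is_deriveZ (e ^- 2) (is_deriveD (is_deriveB H1 (is_deriveZ 2 H2)) H3)).
Qed.

Lemma continuous_tent x e : continuous (tent x e).
Proof.
have H a : continuous (fun s => Num.max 0 (s + a)).
  move=> s; apply: (@continuous_max _ _ (cst 0) (fun s => s + a)); first exact: cvg_cst.
  by apply: cvgD => //; exact: cvg_cst.
move=> s; apply: cvgM; last exact: cvg_cst.
apply: cvgD; last exact: H.
by apply: cvgB; [exact: H|apply: cvgM; [exact: cvg_cst|exact: H]].
Qed.

Lemma smooth_step_le x e s : 0 < e -> s <= x - e -> smooth_step x e s = 0.
Proof.
by move=> e0 se; rewrite /smooth_step /sqr_ramp !max_l; lra.
Qed.

Lemma smooth_step_ge x e s : 0 < e -> x + e <= s -> smooth_step x e s = 1.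
Proof.
move=> e0 se; rewrite /smooth_step /sqr_ramp !max_r; try lra.
by field; rewrite gt_eqF.
Qed.

Lemma smooth_step_itv x e s : 0 < e -> 0 <= smooth_step x e s <= 1.
Proof.
move=> e0; rewrite /smooth_step /sqr_ramp ler_pdivlMr ?ler_pdivrMr ?exprn_gt0//.
case: (leP 0 (s + (e - x))) => ?; case: (leP 0 (s + (- x))) => ?;
  case: (leP 0 (s + (- e - x))) => ?; apply/andP; split; nra.
Qed.

Lemma tent_itv x e s : 0 < e -> 0 <= tent x e s <= e^-1.
Proof.
move=> e0; rewrite /tent ler_pdivlMr ?ler_pdivrMr ?exprn_gt0//.
have -> : e^-1 * e ^+ 2 = e by field; rewrite gt_eqF.
case: (leP 0 (s + (e - x))) => ?; case: (leP 0 (s + (- x))) => ?;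
  case: (leP 0 (s + (- e - x))) => ?; apply/andP; split; lra.
Qed.

Lemma tent_eq0 x e s : 0 < e -> e <= `|s - x| -> tent x e s = 0.
Proof.
move=> e0; rewrite ler_normr => /orP[] H; rewrite /tent.
  by rewrite !max_r; lra.
by rewrite !max_l; lra.
Qed.

End smooth_step.

Lemma ae_mrestr d (T : measurableType d) (R : realType)
    (mu : {measure set T -> \bar R}) (D : set T) (mD : measurable D) (P : T -> Prop) :
  {ae mu, forall x, D x -> P x} -> {ae mrestr mu mD, forall x, P x}.
Proof.
move=> [N [mN N0 PN]]; exists (N `|` ~` D); split.
- by apply: measurableU => //; exact: measurableC.
- rewrite /= /mrestr setIUl setICl setU0.
  by apply: subset_measure0 N0 => //; exact: measurableI.
- move=> x /= Px; have [Dx|] := pselect (D x); last by right.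
  by left; apply: PN => /(_ Dx).
Qed.

Lemma integrable_Lfun2_bounded d (T : measurableType d) (R : realType)
    (nu : {measure set T -> \bar R}) (f h : T -> R) (C : R) :
  nu setT \is a fin_num -> f \in Lfun nu 2%:E -> measurable_fun setT h ->
  (forall x, `|h x| <= C) -> nu.-integrable setT (EFin \o (fun x => f x * h x)).
Proof.
move=> nufin f2 mh hC.
have /Lfun1_integrable f1 := Lfun_subset12 nufin f2.
have mf : measurable_fun setT f.
  by move: f2; rewrite inE => /andP[/[!inE]].
apply: (@le_integrable _ _ _ _ _ measurableT _ (EFin \o (C \o* f))).
- by apply/measurable_EFinP; exact: measurable_funM.
- move=> x _ /=; rewrite lee_fin !normrM ler_wpM2l//.
  by rewrite (le_trans (hC x))// ler_norm.
- have := integrableZr measurableT C f1.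
  by apply: eq_integrable => // x _ /=.
Qed.

Section sobolev.
Context {R : realType}.

Lemma leb01T : (@leb01 R) setT = 1%E.
Proof.
rewrite /leb01/= /mrestr setTI.
by rewrite (@lebesgue_measure_itv R `]0, 1[%R)/= lte_fin ltr01 oppr0 adde0.
Qed.

Lemma leb01_fin : (@leb01 R) setT \is a fin_num.
Proof. by rewrite leb01T. Qed.

Lemma integral_leb01 (f : R -> \bar R) :
  (\int[leb01]_x f x = \int[lebesgue_measure]_(x in `]0%R, 1%R[) f x)%E.
Proof. exact: integral_mrestr. Qed.

Lemma leb01_itv_le (a b : R) : a <= b -> (leb01 `[a, b]%classic <= (b - a)%:E)%E.
Proof.
move=> ab; rewrite /leb01/= /mrestr.
apply: (@le_trans _ _ (lebesgue_measure `[a, b]%classic)).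
  by apply: le_measure; rewrite ?inE//; exact: measurableI.
rewrite [X in (X <= _)%E](@lebesgue_measure_itv R `[a, b]%R)/=; case: ifP => // _.
by rewrite lee_fin subr_ge0.
Qed.

Lemma measurable_tent (x e : R) : measurable_fun setT (tent x e).
Proof. by apply: continuous_measurable_fun; exact: continuous_tent. Qed.

Lemma derive1_smooth_step (x e : R) : derive1 (smooth_step x e) = tent x e.
Proof. by apply/funext => s; rewrite derive1E derive_val. Qed.

Lemma continuous_smooth_step (x e : R) : continuous (smooth_step x e).
Proof.
move=> s; apply/differentiable_continuous/derivable1_diffP.
exact: ex_derive.
Qed.

Lemma integral_tent (x e : R) : 0 < e -> 0 < x - e -> x + e < 1 ->
  (\int[leb01]_s tent x e s = 1)%R.
Proof.
move=> e0 xe0 xe1; rewrite /Rintegral integral_leb01.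
rewrite integral_itv_bndo_bndc; last first.
  by apply/measurable_EFinP; apply: measurable_funTS; exact: measurable_tent.
rewrite integral_itv_obnd_cbnd; last first.
  by apply/measurable_EFinP; apply: measurable_funTS; exact: measurable_tent.
rewrite (@continuous_FTC2 _ _ (smooth_step x e))//.
- rewrite smooth_step_ge ?smooth_step_le ?sube0//; lra.
- by apply: continuous_subspaceT => s; exact: continuous_tent.
- split.
  + by move=> s _; exact: ex_derive.
  + by apply: cvg_at_right_filter; exact: continuous_smooth_step.
  + by apply: cvg_at_left_filter; exact: continuous_smooth_step.
- by move=> s _; rewrite derive1_smooth_step.
Qed.

Lemma derive1_smooth_bump (x e y d : R) :
  derive1 (smooth_step x e - smooth_step y d) = (fun s => tent x e s - tent y d s).
Proof. by apply/funext => s; rewrite derive1E derive_val. Qed.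

Lemma test_function_smooth_bump (x e y d : R) : 0 < e -> 0 < d ->
  0 < x - e -> x + e < 1 -> 0 < y - d -> y + d < 1 ->
  test_function (smooth_step x e - smooth_step y d).
Proof.
move=> e0 d0 xe0 xe1 yd0 yd1; split.
- by move=> s; exact: ex_derive.
- rewrite derive1_smooth_bump => s.
  by apply: cvgB; exact: continuous_tent.
- exists (Num.min (x - e) (y - d)), (Num.max (x + e) (y + d)); split.
  + by rewrite lt_min xe0.
  + by rewrite gt_max xe1.
  + move=> s; apply: contraNT; rewrite ge_min le_max !negb_and !negb_or -!ltNge.
    rewrite -[(_ - _) s]/(smooth_step x e s - smooth_step y d s).
    move=> /orP[|] /andP[h1 h2]; apply/eqP.
      by rewrite !smooth_step_le ?subrr// ltW.
    by rewrite !smooth_step_ge ?subrr// ltW.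
Qed.

Lemma measurable_smooth_step (x e : R) : measurable_fun setT (smooth_step x e).
Proof. by apply: continuous_measurable_fun; exact: continuous_smooth_step. Qed.

Variables u g : R -> R.
Hypotheses (u2 : u \in Lfun leb01 2%:E) (g2 : g \in Lfun leb01 2%:E).
Hypothesis ug : forall phi, test_function phi ->
  (\int[leb01]_x (u x * derive1 phi x))%R = - (\int[leb01]_x (g x * phi x))%R.

(* Tested on [smooth_step x e - smooth_step y (l / 8)], whose derivative is a
   difference of tents; [y] is chosen within [l / 4] of [x] and so that the tent
   at [y] stays in ]0,1[ whatever [x] is. *)
Lemma normr_tent_mean (x l e r1 r2 : R) : 0 < x < 1 -> 0 < l <= 1 -> 0 < e <= l / 8 ->
  e < x -> x < 1 - e -> 0 < r1 -> 0 < r2 ->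
  `|(\int[leb01]_s (u s * tent x e s))%R| <=
    4 / l * (r1 * l + (\int[leb01]_s (u s ^+ 2))%R / r1) +
    2^-1 * (r2 * l + (\int[leb01]_s (g s ^+ 2))%R / r2).
Proof.
move=> /andP[x0 x1] /andP[l0 l1] /andP[e0 el] ex x1e r10 r20.
pose d := l / 8; pose y := x + l / 4 * (1 - 2 * x).
have d0 : 0 < d by rewrite divr_gt0.
have yd0 : 0 < y - d by rewrite /y /d; nra.
have yd1 : y + d < 1 by rewrite /y /d; nra.
have xy : `|y - x| <= l / 4 by rewrite /y ler_norml; apply/andP; split; nra.
pose phi := smooth_step x e - smooth_step y d.
have phiE s : phi s = smooth_step x e s - smooth_step y d s by [].
have tphi : test_function phi by apply: test_function_smooth_bump => //; lra.
have iT z k : 0 < k -> leb01.-integrable setT (EFin \o (fun s => u s * tent z k s)).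
  move=> k0; apply: (@integrable_Lfun2_bounded _ _ _ _ _ _ k^-1 leb01_fin) => //.
    exact: measurable_tent.
  by move=> s; have /andP[h1 h2] := tent_itv z s k0; rewrite ger0_norm.
have phi1 s : `|phi s| <= 1.
  rewrite phiE ler_norml.
  have /andP[? ?] := smooth_step_itv x s e0; have /andP[? ?] := smooth_step_itv y s d0.
  by apply/andP; split; lra.
have mphi : measurable_fun setT phi.
  by apply: measurable_funB; exact: measurable_smooth_step.
have iphi : leb01.-integrable setT (EFin \o (fun s => g s * phi s)).
  exact: (@integrable_Lfun2_bounded _ _ _ _ _ _ 1 leb01_fin).
(* The weak derivative trades the mean of [u] near [x] at width [e] for a mean near [y] at fixed
   width [l / 8], plus an integral of [g]; the resulting bound is independent of [e]. *)
have := ug tphi; rewrite derive1_smooth_bump.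
under eq_Rintegral do rewrite mulrBr.
rewrite RintegralB// ?iT// => /eqP; rewrite subr_eq => /eqP ->.
rewrite addrC -RintegralB// ?iT//.
pose I := `[x - l / 2, x + l / 2]%classic : set R.
have out s : ~ I s -> tent y d s = 0 /\ phi s = 0.
  rewrite /I/= in_itv/= => /negP; rewrite negb_and -!ltNge => sI.
  move: xy; rewrite ler_norml => /andP[xy1 xy2]; split.
    apply: tent_eq0 => //; rewrite /d ler_normr.
    by case/orP: sI => ?; apply/orP; [right|left]; lra.
  rewrite phiE; case/orP: sI => ?.
    by rewrite !smooth_step_le ?subrr//; rewrite /d; lra.
  by rewrite !smooth_step_ge ?subrr//; rewrite /d; lra.
pose B s := 4 / l * (r1 * \1_I s + u s ^+ 2 / r1) + 2^-1 * (r2 * \1_I s + g s ^+ 2 / r2).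
(* A pointwise substitute for Cauchy-Schwarz: the term in [r] is integrated over [I] only, which
   produces the factor [l], and [r] is optimized later. *)
have AMGM (r a k c : R) : 0 < r -> `|k| <= c -> `|a * k| <= c / 2 * (r + a ^+ 2 / r).
  move=> r0 kc; rewrite normrM mulrC.
  apply: (@le_trans _ _ (c * `|a|)); first by rewrite ler_wpM2r.
  have c0 : 0 <= c by rewrite (le_trans _ kc).
  rewrite -mulrA ler_wpM2l// -(ler_pM2l r0) -[a ^+ 2]real_normK ?num_real//.
  have -> : r * (2^-1 * (r + `|a| ^+ 2 / r)) = (r ^+ 2 + `|a| ^+ 2) / 2.
    by field; rewrite gt_eqF.
  by have := sqr_ge0 (r - `|a|); nra.
have bound s : `|u s * tent y d s - g s * phi s| <= B s.
  have [sI|sI] := pselect (I s); last first.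
    have [-> ->] := out _ sI; rewrite !mulr0 subrr normr0.
    have pos (c r a : R) : 0 <= c -> 0 < r -> 0 <= c * (r * \1_I s + a ^+ 2 / r).
      move=> c0 /ltW r0; rewrite mulr_ge0// addr_ge0//; first exact: mulr_ge0.
      by rewrite divr_ge0// sqr_ge0.
    by rewrite addr_ge0// pos// divr_ge0// ltW.
  rewrite /B indicE mem_set//= !mulr1 (le_trans (ler_normB _ _))// lerD//.
    have -> : 4 / l = 8 / l / 2 by field; rewrite gt_eqF.
    apply: AMGM => //; have /andP[h1 h2] := tent_itv y s d0.
    by rewrite ger0_norm// (le_trans h2)// /d invf_div.
  by rewrite -[2^-1]mul1r; exact: AMGM.
have u2i := Lfun2_integrable_sqr u2; have g2i := Lfun2_integrable_sqr g2.
have mI : measurable I by exact: measurable_itv.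
have iI : leb01.-integrable setT (EFin \o \1_I).
  apply/integrableP; split; first exact/measurable_EFinP.
  under eq_integral do rewrite /= ger0_norm//.
  rewrite integral_indic// setIT; apply: le_lt_trans (leb01_itv_le _) (ltry _); lra.
have iB (r c : R) (f : R -> R) : leb01.-integrable setT (EFin \o (fun s => f s ^+ 2)) ->
    leb01.-integrable setT (EFin \o (fun s => c * (r * \1_I s + f s ^+ 2 / r))).
  move=> fi.
  have h1 := integrableZl measurableT r iI.
  have h2 := integrableZr measurableT r^-1 fi.
  have h3 := integrableZl measurableT c (integrableD measurableT h1 h2).
  by apply: eq_integrable h3.
have vB (r c : R) (f : R -> R) : 0 < r -> 0 <= c ->
    leb01.-integrable setT (EFin \o (fun s => f s ^+ 2)) ->
    (\int[leb01]_s (c * (r * \1_I s + f s ^+ 2 / r)))%R <=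
    c * (r * l + (\int[leb01]_s (f s ^+ 2))%R / r).
  move=> r0 c0 fi.
  have h1 := integrableZl measurableT r iI.
  have h2 := integrableZr measurableT r^-1 fi.
  rewrite RintegralZl//; last by apply: eq_integrable (integrableD measurableT h1 h2).
  rewrite ler_wpM2l// RintegralD// RintegralZl// RintegralZr// lerD2r ler_wpM2l ?(ltW r0)//.
  rewrite /Rintegral integral_indic// setIT.
  have H : (leb01 I <= l%:E)%E.
    have -> : l = x + l / 2 - (x - l / 2) by field.
    by apply: leb01_itv_le; lra.
  rewrite -lee_fin fineK// ge0_fin_numE//.
  exact: le_lt_trans H (ltry _).
have iD : leb01.-integrable setT (EFin \o (fun s => u s * tent y d s - g s * phi s)).
  by apply: eq_integrable (integrableB measurableT (iT y d d0) iphi).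
apply: (le_trans (le_normr_Rintegral measurableT iD)).
apply: (@le_trans _ _ (\int[leb01]_s B s)%R).
  apply: le_Rintegral => //; first by apply: eq_integrable (integrable_abse iD).
  by apply: eq_integrable (integrableD measurableT (iB r1 (4 / l) u u2i) (iB r2 2^-1 g g2i)).
rewrite RintegralD//; [|exact: iB|exact: iB].
by rewrite lerD// vB// divr_ge0// ltW.
Qed.

End sobolev.

(** * Recovering values at Lebesgue points *)

Section lebesgue_points.
Context {R : realType}.
Variable u : R -> R.
Hypothesis u2 : u \in Lfun leb01 2%:E.
(** The representative is uncontrolled outside the open interval; extended by 0 it is integrable on
    the line, as Lebesgue differentiation requires. *)
Let v := u \_ `]0, 1[.

Let mu : measurable_fun setT u.
Proof. by move: u2; rewrite inE => /andP[/[!inE]]. Qed.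

Let mv : measurable_fun setT v.
Proof.
apply/(measurable_restrictT u (measurable_itv `]0, 1[%R)).
exact: measurable_funTS.
Qed.

Lemma ae_lebesgue_pt_restrict : {ae lebesgue_measure, forall x, lebesgue_pt v x}.
Proof.
apply: lebesgue_differentiation; apply: open_integrable_locally; first exact: openT.
have /Lfun1_integrable/integrableP[_ u1] := Lfun_subset12 leb01_fin u2.
apply/integrableP; split; first exact/measurable_EFinP.
move: u1; rewrite integral_leb01 integral_mkcond.
apply: le_lt_trans; rewrite le_eqVlt; apply/orP; left; apply/eqP.
apply: eq_integral => x _ /=.
by rewrite /v /patch; case: ifP => // _; rewrite normr0.
Qed.

(** The hat is at most [1 / e] on a ball of measure [2 * e], so its mean of [u] differs from [u x]
    by at most twice the average oscillation; hence the tolerance [eta / 2]. *)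
Lemma normr_le_tent_mean x B e1 : 0 < x < 1 -> lebesgue_pt v x -> 0 < e1 ->
  (forall e, 0 < e <= e1 -> e < x -> x < 1 - e -> `|(\int[leb01]_s (u s * tent x e s))%R| <= B) ->
  `|u x| <= B.
Proof.
move=> /andP[x0 x1] /fine_cvgP[dfin /cvgrPdist_le d0] e10 HB.
apply/ler_addgt0Pr => eta eta0.
have eta2 : 0 < eta / 2 by rewrite divr_gt0.
near (0 : R)^'+ => e.
have e0 : 0 < e by near: e; exact: nbhs_right_gt.
have ee1 : e <= e1 by near: e; exact: nbhs_right_le.
have ex : e < x by near: e; exact: nbhs_right_lt.
have e1x : e < 1 - x by near: e; apply: nbhs_right_lt; rewrite subr_gt0.
have x1e : x < 1 - e by lra.
have dfe : davg v x e \is a fin_num by near: e.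
have : `|0 - fine (davg v x e)| <= eta / 2 by near: e; exact: d0.
rewrite sub0r normrN => /(le_trans (ler_norm _)).
rewrite -lee_fin fineK// => de.
have iu : leb01.-integrable setT (EFin \o (fun s => u s * tent x e s)).
  apply: (@integrable_Lfun2_bounded _ _ _ _ _ _ e^-1 leb01_fin) => //.
    exact: measurable_tent.
  by move=> s; have /andP[h1 h2] := tent_itv x s e0; rewrite ger0_norm.
have it : leb01.-integrable setT (EFin \o tent x e).
  apply: (@measurable_bounded_integrable _ _ _ leb01) => //.
  - by rewrite leb01T ltry.
  - exact: measurable_tent.
  - exists e^-1; split; first exact: num_real.
    move=> M eM s _ /=; have /andP[h1 h2] := tent_itv x s e0.
    by rewrite ger0_norm// (le_trans h2)// ltW.
have iut : leb01.-integrable setT (EFin \o (fun s => u x * tent x e s)).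
  by apply: eq_integrable (integrableZl measurableT (u x) it).
have E : (\int[leb01]_s (u s * tent x e s))%R - u x =
    (\int[leb01]_s ((u s - u x) * tent x e s))%R.
  under [RHS]eq_Rintegral do rewrite mulrBl.
  rewrite RintegralB// RintegralZl// integral_tent ?mulr1//; lra.
have mt : measurable_fun setT (tent x e) by exact: measurable_tent.
have md : measurable_fun setT (fun s => (u s - u x) * tent x e s).
  by apply: measurable_funM => //; exact: measurable_funB.
have iE : leb01.-integrable setT (EFin \o (fun s => (u s - u x) * tent x e s)).
  apply: eq_integrable (integrableB measurableT iu iut) => // s _.
  by rewrite /= mulrBl EFinB.
have key : `|(\int[leb01]_s ((u s - u x) * tent x e s))%R| <= eta.
  rewrite -lee_fin EFin_normr_Rintegral//.
  apply: (le_trans (le_abse_integral _ _ _)) => //; first exact/measurable_EFinP.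
  have -> : eta%:E = (e^-1%:E * ((e *+ 2)%:E * (eta / 2)%:E))%E.
    by rewrite -!EFinM; congr EFin; rewrite mulr2n; field; rewrite gt_eqF.
  apply: (@le_trans _ _ (e^-1%:E * (\int[lebesgue_measure]_(s in ball x e) `|(v s - v x)%:E|))%E).
    rewrite -ge0_integralZl//; last 3 first.
    - exact: measurable_ball.
    - do 2 apply: measurableT_comp => //.
      by apply: measurable_funTS; exact: measurable_funB.
    - by rewrite lee_fin invr_ge0 ltW.
    rewrite integral_leb01 [leLHS]integral_mkcond [leRHS]integral_mkcond.
    apply: ge0_le_integral => //.
    - by move=> s _; apply: erestrict_ge0 => *; exact: abse_ge0.
    - apply/(measurable_restrictT _ (measurable_itv `]0, 1[%R)).
      apply: measurableT_comp => //.
      by apply/measurable_EFinP; exact: measurable_funTS.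
    - apply/(measurable_restrictT _ (measurable_ball x e)).
      apply: measurable_funTS; apply: emeasurable_funM; first exact: measurable_cst.
      apply: measurableT_comp => //; apply/measurable_EFinP.
      exact: measurable_funB.
    move=> s _; rewrite /patch; case: ifPn => s01; last first.
      by case: ifPn => // _; rewrite mule_ge0 ?abse_ge0// lee_fin invr_ge0 ltW.
    have x01 : x \in `]0, 1[%classic by rewrite inE/= in_itv/= x0.
    have vs : v s = u s by rewrite /v patchT.
    have vx : v x = u x by rewrite /v patchT.
    case: ifPn => [_|].
      rewrite vs vx -EFinM lee_fin normrM mulrC ler_wpM2r//.
      by have /andP[h1 h2] := tent_itv x s e0; rewrite ger0_norm.
    rewrite notin_setE /ball/= => /negP; rewrite -leNgt distrC => es.
    by rewrite (tent_eq0 e0 es) mulr0 normr0.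
  rewrite lee_pmul2l ?lte_fin ?invr_gt0//.
  move: de; rewrite /davg /iavg lebesgue_measure_ball ?(ltW e0)//.
  rewrite inver gt_eqF ?mulrn_wgt0// lee_pdivrMl ?mulrn_wgt0//.
have := HB e; rewrite e0 ee1 => /(_ isT ex x1e) HB'.
rewrite (_ : u x = (\int[leb01]_s (u s * tent x e s))%R -
  (\int[leb01]_s ((u s - u x) * tent x e s))%R); last by rewrite -E opprB addrC subrK.
by rewrite (le_trans (ler_normB _ _))// lerD.
Unshelve. all: by end_near. Qed.

End lebesgue_points.

Lemma sobolev_interpolation (R : realType) (u g : R -> R) (a K s : R) :
  u \in Lfun leb01 2%:E -> g \in Lfun leb01 2%:E ->
  (forall phi, test_function phi ->
    (\int[leb01]_x (u x * derive1 phi x))%R = - (\int[leb01]_x (g x * phi x))%R) ->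
  0 < a -> 0 < K -> 0 < s <= 1 ->
  (\int[leb01]_x (u x ^+ 2))%R <= a ^+ 2 ->
  (\int[leb01]_x (g x ^+ 2))%R <= (K * a / s ^+ 2) ^+ 2 ->
  {ae leb01, forall x, `|u x| <= (8 + K) * a / s}.
Proof.
move=> u2 g2 ug a0 K0 /andP[s0 s1] ua ga.
apply: ae_mrestr; have [E [mE E0 HE]] := ae_lebesgue_pt_restrict u2.
exists E; split => // x /= Hx; apply: HE => /= Lx; apply: Hx.
rewrite in_itv/= => x01.
have l01 : 0 < s ^+ 2 <= 1 by rewrite exprn_gt0//= expr_le1// ltW.
have l8 : 0 < s ^+ 2 / 8 by rewrite divr_gt0// exprn_gt0.
apply: (normr_le_tent_mean u2 x01 Lx l8) => e e8 ex x1e.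
(* These two parameters equalize the summands in each bracket at [l = s ^+ 2]; the brackets then
   contribute [8 * a / s] and [K * a / s]. *)
have r1 : 0 < a / s by rewrite divr_gt0.
have r2 : 0 < K * a / s ^+ 3 by rewrite divr_gt0 ?exprn_gt0 ?mulr_gt0.
apply: (le_trans (normr_tent_mean u2 g2 ug x01 l01 e8 ex x1e r1 r2)).
have -> : (8 + K) * a / s = 4 / s ^+ 2 * (a / s * s ^+ 2 + a ^+ 2 / (a / s)) +
    2^-1 * (K * a / s ^+ 3 * s ^+ 2 + (K * a / s ^+ 2) ^+ 2 / (K * a / s ^+ 3)).
  by field; rewrite !gt_eqF.
rewrite lerD// ler_wpM2l ?divr_ge0 ?exprn_ge0 ?(ltW s0)//.
  by rewrite lerD2l ler_wpM2r// invr_ge0 ltW.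
by rewrite lerD2l ler_wpM2r// invr_ge0 ltW.
Qed.

(** * The space X_2 and the semigroup on it *)

Section complex_L2.
Context {R : realType}.
Implicit Types z w : R[i].

Lemma Re_mulC z (r : R) : complex.Re (z * r%:C%C) = complex.Re z * r.
Proof. by case: z => a b /=; rewrite mulr0 subr0. Qed.

Lemma Im_mulC z (r : R) : complex.Im (z * r%:C%C) = complex.Im z * r.
Proof. by case: z => a b /=; rewrite mulr0 add0r. Qed.

Lemma ReD z w : complex.Re (z + w) = complex.Re z + complex.Re w.
Proof. by case: z; case: w. Qed.

Lemma ImD z w : complex.Im (z + w) = complex.Im z + complex.Im w.
Proof. by case: z; case: w. Qed.

Lemma Re_mul_conjc z w :
  complex.Re (z * conjc w) = complex.Re z * complex.Re w + complex.Im z * complex.Im w.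
Proof. by case: z => a b; case: w => c d /=; rewrite mulrN opprK. Qed.

Lemma ReZ (a : R) (z : Rcomplex R) : complex.Re (a *: z) = a * complex.Re z.
Proof. by case: z. Qed.

Lemma ImZ (a : R) (z : Rcomplex R) : complex.Im (a *: z) = a * complex.Im z.
Proof. by case: z. Qed.

Lemma Lfun2_of_integral d (T : measurableType d) (nu : {measure set T -> \bar R})
    (f : T -> R) : measurable_fun setT f ->
  (\int[nu]_x (f x ^+ 2)%:E < +oo)%E -> f \in Lfun nu 2%:E.
Proof.
move=> mf fi; rewrite inE; apply/andP; split; rewrite inE//=.
rewrite /finite_norm unlock /Lnorm poweR_lty//.
under eq_integral do rewrite /= powR_mulrn// -normrX ger0_norm ?sqr_ge0//.
exact: fi.
Qed.

End complex_L2.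

Section X2.
Context {R : realType} {m : nat}.
Variable mu : 'I_m -> {posnum R}.

Local Notation fam := ('I_m -> R -> Rcomplex R).
Local Notation nu j := (weighted_leb01 (mu j)).

Definition X2_pred : {pred fam} := fun f => `[< in_X mu 2%:E f >].

Lemma cLfun_ZD (w : {measure set (measurableTypeR R) -> \bar R}) a (f g : R -> Rcomplex R) :
  cLfun w 2%:E f -> cLfun w 2%:E g -> cLfun w 2%:E (a *: f + g).
Proof.
move=> [f1 f2] [g1 g2]; split.
  rewrite (_ : (fun x => _) = a *: (fun x => complex.Re (f x)) + (fun x => complex.Re (g x))).
    exact: (LfunP (a *: Lfun_Sub (lee1n 2) f1 + Lfun_Sub (lee1n 2) g1)).
  by apply/funext => x; rewrite -[(a *: f + g) x]/(a *: f x + g x) ReD ReZ.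
rewrite (_ : (fun x => _) = a *: (fun x => complex.Im (f x)) + (fun x => complex.Im (g x))).
  exact: (LfunP (a *: Lfun_Sub (lee1n 2) f2 + Lfun_Sub (lee1n 2) g2)).
by apply/funext => x; rewrite -[(a *: f + g) x]/(a *: f x + g x) ImD ImZ.
Qed.

Lemma X2_submod_closed : submod_closed X2_pred.
Proof.
split=> [|a f g /asboolP Hf /asboolP Hg]; apply/asboolP => j.
  by split; exact: (LfunP (0 : LfunType (nu j) (lee1n 2))).
exact: cLfun_ZD.
Qed.

HB.instance Definition _ := GRing.isSubmodClosed.Build R fam X2_pred X2_submod_closed.

Record X2 := MkX2 { X2_fam :> fam; X2_famP : X2_pred X2_fam }.
HB.instance Definition _ := [isSub for X2_fam].
HB.instance Definition _ := [Choice of X2 by <:].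
HB.instance Definition _ := [SubChoice_isSubLmodule of X2 by <:].

(** The real part of the Hermitian product induces the same norm and makes X_2 a real semi-inner
    product space, to which the abstract results apply. *)
Definition X2_sip (f g : X2) : R := complex.Re (X2_dot mu f g).

Lemma X2P (f : X2) : in_X mu 2%:E f.
Proof. by have /asboolP := X2_famP f. Qed.

Lemma integrable_mul2 j (f g : R -> R) : f \in Lfun (nu j) 2%:E -> g \in Lfun (nu j) 2%:E ->
  (nu j).-integrable setT (EFin \o (fun x => f x * g x)).
Proof. by move=> f2 g2; exact/Lfun1_integrable/Lfun2_mul_Lfun1. Qed.

Lemma Re_sum (I : Type) (r : seq I) (F : I -> R[i]) :
  complex.Re (\sum_(i <- r) F i) = \sum_(i <- r) complex.Re (F i).
Proof. by elim/big_rec2: _ => // i x y _ <-; rewrite ReD. Qed.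

Lemma X2_sipE (f g : X2) : X2_sip f g = \sum_j
  ((\int[nu j]_x (complex.Re (f j x) * complex.Re (g j x)))%R +
   (\int[nu j]_x (complex.Im (f j x) * complex.Im (g j x)))%R).
Proof.
rewrite /X2_sip /X2_dot Re_sum; apply: eq_bigr => j _ /=.
have [f1 f2] := X2P f j; have [g1 g2] := X2P g j.
rewrite -RintegralD//; [|exact: integrable_mul2|exact: integrable_mul2].
by apply: eq_Rintegral => x _; rewrite Re_mul_conjc.
Qed.

Lemma X2_semi_inner_product : semi_inner_product X2_sip.
Proof.
split=> [f g|f g h|a f g|f].
- rewrite !X2_sipE; apply: eq_bigr => j _; congr (_ + _);
    by apply: eq_Rintegral => x _; rewrite mulrC.
- rewrite !X2_sipE -big_split; apply: eq_bigr => j _ /=.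
  have [f1 f2] := X2P f j; have [g1 g2] := X2P g j; have [h1 h2] := X2P h j.
  rewrite addrACA; congr (_ + _); (rewrite -RintegralD//; try exact: integrable_mul2);
    by apply: eq_Rintegral => x _; rewrite -mulrDl -?ReD -?ImD.
- rewrite !X2_sipE mulr_sumr; apply: eq_bigr => j _ /=.
  have [f1 f2] := X2P f j; have [g1 g2] := X2P g j.
  rewrite mulrDr; congr (_ + _); (rewrite -RintegralZl//; try exact: integrable_mul2);
    by apply: eq_Rintegral => x _; rewrite mulrA -?ReZ -?ImZ.
- rewrite X2_sipE; apply: sumr_ge0 => j _.
  by rewrite addr_ge0// Rintegral_ge0// => x _; rewrite -expr2 sqr_ge0.
Qed.

Lemma X2_normE (f : X2) : X2_norm mu f = seminorm X2_sip f.
Proof. by []. Qed.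

End X2.

Section X2_complete.
Context {R : realType} {m : nat}.
Variable mu : 'I_m -> {posnum R}.

Local Notation fam := ('I_m -> R -> Rcomplex R).
Local Notation nu j := (weighted_leb01 (mu j)).
Local Notation X2 := (X2 mu).
Local Notation sip := (@X2_sip R m mu).
Local Notation N := (seminorm sip).
Let sipP := X2_semi_inner_product mu.

(** Indexing real and imaginary parts by a boolean lets each scalar estimate be proved once for
    both. *)
Definition part (b : bool) (z : R[i]) : R := if b then complex.Re z else complex.Im z.

Lemma Lfun_part b (f : X2) j : (fun x => part b (f j x)) \in Lfun (nu j) 2%:E.
Proof. by case: b; have [] := X2P f j. Qed.

Lemma measurable_Lfun2 d (T : measurableType d) (w : {measure set T -> \bar R})
  (f : T -> R) : f \in Lfun w 2%:E -> measurable_fun setT f.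
Proof. by rewrite inE => /andP[/[!inE]]. Qed.

Lemma partB b (z w : R[i]) : part b (z - w) = part b z - part b w.
Proof. by case: b; case: z; case: w. Qed.

Lemma X2_sip_part (f : X2) :
  sip f f = \sum_j \sum_b (\int[nu j]_x (part b (f j x) ^+ 2))%R.
Proof. by rewrite X2_sipE; apply: eq_bigr => j _; rewrite big_bool. Qed.

Lemma integral_part_le b (f : X2) j :
  (\int[nu j]_x (part b (f j x) ^+ 2)%:E <= (N f ^+ 2)%:E)%E.
Proof.
have i2 := Lfun2_integrable_sqr (Lfun_part b f j).
rewrite -(fineK (integrable_fin_num measurableT i2)) lee_fin.
rewrite (sqr_seminorm sipP) X2_sip_part (bigD1 j)//= (bigD1 b)//= -addrA lerDl.
by rewrite addr_ge0// sumr_ge0// => k _; rewrite ?sumr_ge0// => *;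
  rewrite Rintegral_ge0// => x _; rewrite sqr_ge0.
Qed.

Lemma X2_sip_le (f : X2) c :
  (forall j b, (\int[nu j]_x (part b (f j x) ^+ 2)%:E <= c%:E)%E) ->
  sip f f <= (2 * m)%:R * c.
Proof.
move=> fc; rewrite X2_sip_part.
apply: (@le_trans _ _ (\sum_(j < m) \sum_(b : bool) c)).
  apply: ler_sum => j _; apply: ler_sum => b _.
  have i2 := Lfun2_integrable_sqr (Lfun_part b f j).
  by rewrite -lee_fin fineK ?fc//; exact: integrable_fin_num.
by rewrite !sumr_const card_bool card_ord -mulrnA mulr_natl.
Qed.

(** Riesz-Fischer is applied to each of the [2 * m] real components; its constant 4 is the square of
    the 2 in the tail bound [2 * 2^-k]. *)
Lemma X2_complete : complete_sip sip.
Proof.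
move=> x Hx.
have x_dist k n : N (x (k + n)%N - x k) <= 2 * 2^-1 ^+ k * (1 - 2^-1 ^+ n).
  elim: n => [|n IH]; first by rewrite addn0 subrr (seminorm0 sipP) expr0 subrr mulr0.
  rewrite addnS (le_trans (seminorm_triangle sipP (x (k + n)%N) _ _))//.
  by rewrite (le_trans (lerD (Hx _) IH))// exprD !exprS; lra.
have pow4 k : 4 * 4^-1 ^+ k = (2 * 2^-1 ^+ k) ^+ 2 :> R.
  elim: k => [|k IH]; first by rewrite !expr0; ring.
  by rewrite !exprS mulrCA IH; field.
have half0 k : 0 <= 2^-1 ^+ k :> R by rewrite exprn_ge0// invr_ge0.
have RF (jb : 'I_m * bool) : exists l : R -> R, measurable_fun setT l /\
    forall k, (\int[nu jb.1]_s ((part jb.2 (x k jb.1 s) - l s) ^+ 2)%:E <=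
      (4 * 4^-1 ^+ k)%:E)%E.
  case: jb => j b /=.
  have [|k n kn|l ml Hl] := @riesz_fischer _ _ _ (nu j) (fun k s => part b (x k j s)) 4.
  - by move=> k; exact: measurable_Lfun2 (Lfun_part b (x k) j).
  - under eq_integral do rewrite -partB.
    rewrite (le_trans (integral_part_le b (x n - x k) j))// lee_fin.
    rewrite pow4.
    rewrite lerXn2r ?nnegrE ?seminorm_ge0 ?mulr_ge0//.
    rewrite -(subnKC kn) (le_trans (x_dist _ _))// ler_piMr ?mulr_ge0//.
  - by exists l.
have [l Hl] := choice RF.
pose L : fam := fun j s => Complex (l (j, true) s) (l (j, false) s).
have LP : X2_pred mu L.
  apply/asboolP => j.
  have H b : l (j, b) \in Lfun (nu j) 2%:E.
    have [ml /(_ 0%N) Hl0] := Hl (j, b).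
    have d2 : (fun s => part b (x 0%N j s) - l (j, b) s) \in Lfun (nu j) 2%:E.
      apply: Lfun2_of_integral.
        by apply: measurable_funB => //; exact: measurable_Lfun2 (Lfun_part b (x 0%N) j).
      by rewrite (le_lt_trans Hl0)// ltry.
    have x2 := Lfun_part b (x 0%N) j.
    rewrite (_ : l (j, b) = (fun s => part b (x 0%N j s)) -
      (fun s => part b (x 0%N j s) - l (j, b) s)).
      exact: (LfunP (Lfun_Sub (lee1n 2) x2 - Lfun_Sub (lee1n 2) d2)).
    by apply/funext => s; rewrite -[RHS]/(part b (x 0%N j s) -
      (part b (x 0%N j s) - l (j, b) s)) opprB addrC subrK.
  by split; [exact: (H true)|exact: (H false)].
exists (MkX2 LP) => e e0.
have partL b s j : part b (L j s) = l (j, b) s by case: b.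
have N2 k : sip (x k - MkX2 LP) (x k - MkX2 LP) <= (2 * m)%:R * (4 * 4^-1 ^+ k).
  apply: X2_sip_le => j b; have [_ /(_ k)] := Hl (j, b); apply: le_trans.
  rewrite le_eqVlt; apply/orP; left; apply/eqP; apply: eq_integral => s _.
  by rewrite -partL -partB.
pose k0 := (Num.truncn ((2 * m)%:R * 4 / e ^+ 2)).+1.
exists k0 => k k0k.
rewrite -(@ler_pXn2r _ 2)// ?nnegrE ?seminorm_ge0 ?(ltW e0)// (sqr_seminorm sipP).
have large : (2 * m)%:R * 4 / e ^+ 2 <= 2 ^+ k.
  rewrite (le_trans (ltW (truncnS_gt _)))// -natrX ler_nat (leq_trans k0k)//.
  by rewrite ltnW// ltn_expl.
rewrite (le_trans (N2 k))// [4^-1 ^+ k]exprVn mulrA ler_pdivrMr ?exprn_gt0// [leRHS]mulrC.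
rewrite -ler_pdivrMr ?exprn_gt0// (le_trans large)//.
by rewrite lerXn2r ?nnegrE//; lra.
Qed.

End X2_complete.

Section network_semigroup.
Context {R : realType} {n m : nat}.
Variables (src tgt : 'I_m -> 'I_n) (mu : 'I_m -> {posnum R}) (c : 'I_m -> R -> R).

Local Notation fam := ('I_m -> R -> Rcomplex R).
Local Notation nu j := (weighted_leb01 (mu j)).
Local Notation X2 := (X2 mu).
Local Notation sip := (@X2_sip R m mu).
Local Notation N := (seminorm sip).
Let sipP := X2_semi_inner_product mu.

Lemma integral_weighted j (f : R -> \bar R) : measurable_fun setT f ->
  (forall x, 0 <= f x)%E ->
  (\int[nu j]_x f x = ((mu j)%:num)%:E * \int[leb01]_x f x)%E.
Proof. by move=> mf f0; rewrite ge0_integral_mscale. Qed.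

Lemma seminorm_X_eq (x y : X2) : X_eq x y -> N (x - y) = 0.
Proof.
move=> xy; rewrite /seminorm (_ : sip _ _ = 0) ?sqrtr0//.
apply/eqP; rewrite eq_le (sip_ge0 sipP) andbT -[leRHS](mulr0 (2 * m)%:R).
apply: X2_sip_le => j b.
have mp : measurable_fun setT (fun s => part b ((x - y) j s)).
  exact: measurable_Lfun2 (Lfun_part b (x - y) j).
have mp2 : measurable_fun setT (fun s => (part b ((x - y) j s) ^+ 2)%:E).
  by apply/measurable_EFinP/measurable_funX.
rewrite integral_weighted//; last by move=> s; rewrite lee_fin sqr_ge0.
suff -> : (\int[leb01]_s (part b ((x - y) j s) ^+ 2)%:E = \int[leb01]_s (cst 0 s))%E.
  by rewrite integral0 mule0.
apply: ae_eq_integral => //.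
have [E [mE E0 HE]] := xy j; exists E; split => // s /= Hs; apply: HE => /= Hxy.
apply: Hs => _.
rewrite -[LHS]/((part b ((x : fam) j s - (y : fam) j s) ^+ 2)%:E) Hxy subrr.
by case: b {mp mp2}; rewrite /= expr2 mulr0.
Qed.

Lemma scale_realC (a : R) (z : Rcomplex R) : a *: z = a%:C%C * z :> R[i].
Proof.
by case: z => p q; apply/eqP; rewrite eq_complex /= !mul0r subr0 addr0 !eqxx.
Qed.

Variable T : R -> ('I_m -> R -> R[i]) -> ('I_m -> R -> R[i]).
Hypothesis TA : semigroup_generated_by_A src tgt mu c T.

(* [insubd] only matters for [t < 0], where [T t] need not preserve X_2. *)
Definition sgT (t : R) (x : X2) : X2 := insubd x (T t x : fam).

Lemma sgTE t (x : X2) : 0 <= t -> sgT t x = T t x :> fam.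
Proof.
move=> t0; rewrite /sgT val_insubd ifT//; apply/asboolP.
by have [[/(_ t t0) [H _ _] _] _] := TA; apply/H/X2P.
Qed.

Lemma sgT_semigroup : sip_semigroup sip sgT.
Proof.
have [[TX [T0 TD Tc]] _] := TA; split.
- move=> t a x y t0; apply: seminorm_X_eq => j.
  have [_ /(_ a%:C%C x y (X2P x) (X2P y) j) H _] := TX t t0.
  rewrite sgTE//; move: H; congr ({ae _, forall x, _}).
  apply/funext => s; congr (_ = _).
    congr (T t _ j s); apply/funext => i; apply/funext => r.
    by rewrite -scale_realC.
  by rewrite -scale_realC -!sgTE.
- move=> t t0; have [_ _ [C HC]] := TX t t0; exists C => x.
  by have := HC x (X2P x); rewrite -sgTE.
- move=> x; apply: seminorm_X_eq; rewrite sgTE//; exact: T0 (X2P x).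
- move=> s t x s0 t0; apply: seminorm_X_eq.
  by rewrite !sgTE ?addr_ge0//; exact: TD (X2P x).
- move=> x e e0; have /cvgrPdist_le /(_ e e0)[d /= d0 Hd] := Tc x (X2P x).
  exists (d / 2) => [|t /andP[t0 td]]; first by rewrite divr_gt0.
  (* The one-sided limit says nothing at [t = 0], which the identity at time 0 supplies. *)
  have [->|tn0] := eqVneq t 0.
    rewrite (_ : N _ = 0) ?ltW//; apply: seminorm_X_eq; rewrite sgTE//; exact: T0 (X2P x).
  have tpos : 0 < t by rewrite lt_neqAle eq_sym tn0.
  have := Hd t; rewrite /ball/= !sub0r !normrN (ger0_norm t0) => /(_ _ tpos).
  rewrite ger0_norm ?sqrtr_ge0// => H.
  have := H; rewrite -sgTE//; apply; lra.
Qed.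

Lemma sg_generatorW (f g : X2) : sg_generator sip sgT f g -> generator mu T f g.
Proof.
move=> fg; split; [exact: X2P|exact: X2P|].
apply/cvgrPdist_le => e e0; have [d d0 Hd] := fg e e0.
exists d => //= t; rewrite /ball/= sub0r normrN => td t0.
rewrite sub0r normrN ger0_norm ?sqrtr_ge0//.
have := Hd t; rewrite t0 => /=.
have t0' := ltW t0; rewrite (ger0_norm t0') in td.
move=> /(_ (ltW td)); rewrite -[X in X <= _]X2_normE; congr (X2_norm _ _ <= _).
apply/funext => j; apply/funext => s.
by rewrite -scale_realC -sgTE.
Qed.

(** [op_A f] is minus a chosen representing element, and [g] agrees with it almost everywhere only;
    the difference has seminorm 0 and disappears in the pairing. *)
Lemma sg_generator_form (f g : X2) : sg_generator sip sgT f g ->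
  form_domain src tgt f /\
  forall h : X2, form_domain src tgt h -> complex.Re (form_a mu c f h) = - sip g h.
Proof.
move=> /sg_generatorW; have [_ TgenA] := TA.
move=> /TgenA [[fV fr] _ Afg]; split=> // h hV.
pose g0 := xget (fun _ _ => 0) [set g | represents src tgt mu c f g].
have [g0X g0h] : represents src tgt mu c f g0 by exact: xgetPex.
pose G0 : X2 := MkX2 (asboolT g0X : X2_pred mu g0).
rewrite g0h// -[LHS]/(sip G0 h) -[LHS]opprK; congr (- _).
rewrite -(sipNl sipP); apply: (sip_eqv sipP).
exact: seminorm_X_eq.
Qed.

End network_semigroup.

(** * Energy form and smoothing *)

Section form.
Context {R : realType} {n m : nat}.
Variables (src tgt : 'I_m -> 'I_n) (mu : 'I_m -> {posnum R}) (c : 'I_m -> R -> R).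
Hypothesis cC1 : forall j, C1_01 (c j).
Hypothesis cpos : forall j x, 0 <= x <= 1 -> 0 < c j x.

Lemma Re_form_integrand (a : R) (z w : R[i]) : complex.Re (a%:C%C * z * conjc w) =
  a * (complex.Re z * complex.Re w + complex.Im z * complex.Im w).
Proof. by case: z => p q; case: w => k l /=; ring. Qed.

Lemma Re_form_aE f h : complex.Re (form_a mu c f h) =
  \sum_j (\int[leb01]_x ((mu j)%:num * c j x *
    (complex.Re (wderiv (f j) x) * complex.Re (wderiv (h j) x) +
     complex.Im (wderiv (f j) x) * complex.Im (wderiv (h j) x))))%R.
Proof.
rewrite /form_a Re_sum; apply: eq_bigr => j _ /=.
by apply: eq_Rintegral => x _; rewrite Re_form_integrand.
Qed.

Lemma Re_form_a_sym f h :
  complex.Re (form_a mu c f h) = complex.Re (form_a mu c h f).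
Proof.
apply: (etrans (Re_form_aE f h)); apply: (etrans _ (esym (Re_form_aE h f))).
apply: eq_bigr => j _.
have comm (a p q k l : R) : a * (p * q + k * l) = a * (q * p + l * k) by ring.
by apply: eq_Rintegral => x _; exact: comm.
Qed.

Lemma Re_form_a_term_ge0 f j : 0 <= (\int[leb01]_x ((mu j)%:num * c j x *
    (complex.Re (wderiv (f j) x) * complex.Re (wderiv (f j) x) +
     complex.Im (wderiv (f j) x) * complex.Im (wderiv (f j) x))))%R.
Proof.
rewrite /Rintegral fine_ge0// integral_leb01 integral_ge0// => x /=.
rewrite in_itv/= => /andP[x0 x1]; rewrite lee_fin mulr_ge0//.
  by rewrite mulr_ge0// ltW// cpos// !ltW.
by rewrite addr_ge0// -expr2 sqr_ge0.
Qed.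

Lemma Re_form_a_ge0 f : 0 <= complex.Re (form_a mu c f f).
Proof. by rewrite (Re_form_aE f f) sumr_ge0// => j _; exact: Re_form_a_term_ge0. Qed.

Lemma integrable_leb01 (f : R -> \bar R) : leb01.-integrable setT f ->
  lebesgue_measure.-integrable `]0%R, 1%R[ f.
Proof.
move=> /integrableP[mf fi]; apply/integrableP; split.
  exact: measurable_funTS.
by rewrite -integral_leb01.
Qed.

Lemma wderivP (f : R -> R[i]) : H1 f -> cLfun leb01 2%:E (wderiv f) /\ weak_derivative f (wderiv f).
Proof.
move=> [_ [g g2 fg]].
pose S := [set g : R -> R[i] | cLfun leb01 2%:E g /\ weak_derivative f g].
have Sg : S g by [].
exact: (xgetPex (fun=> 0 : R[i]) (ex_intro S g Sg)).
Qed.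

Lemma weak_derivative_part b (f g : R -> R[i]) phi : weak_derivative f g ->
  test_function phi ->
  (\int[leb01]_x (part b (f x) * derive1 phi x))%R =
  - (\int[leb01]_x (part b (g x) * phi x))%R.
Proof.
move=> fg /fg/(congr1 (part b)); rewrite /cintegral; case: b => /= H.
  under eq_Rintegral do rewrite -Re_mulC.
  by rewrite H; congr (- _); apply: eq_Rintegral => x _; rewrite Re_mulC.
under eq_Rintegral do rewrite -Im_mulC.
by rewrite H; congr (- _); apply: eq_Rintegral => x _; rewrite Im_mulC.
Qed.

Lemma form_coercive j : exists2 k, 0 < k &
  forall f b, form_domain src tgt f ->
  k * (\int[leb01]_x (part b (wderiv (f j) x) ^+ 2))%R <= complex.Re (form_a mu c f f).
Proof.
have [cc _ _] := cC1 j.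
have [x0 x01 xmin] := EVT_min ler01 cc; have [y0 y01 ymax] := EVT_max ler01 cc.
have cx0 : 0 < c j x0 by apply: cpos; move: x01; rewrite in_itv.
exists ((mu j)%:num * c j x0) => [|f b [fH _]]; first by rewrite mulr_gt0.
have [[w1 w2] _] := wderivP (fH j).
rewrite (Re_form_aE f f) (bigD1 j)//= -[leLHS]addr0 lerD//; last first.
  by rewrite sumr_ge0// => k _; exact: Re_form_a_term_ge0.
set w := wderiv (f j) in w1 w2 *.
have i1 := Lfun2_integrable_sqr w1; have i2 := Lfun2_integrable_sqr w2.
have ib : leb01.-integrable setT (EFin \o (fun x => part b (w x) ^+ 2)) by case: b.
have ikb := integrableZl measurableT ((mu j)%:num * c j x0) ib.
rewrite -RintegralZl// /Rintegral !integral_leb01.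
have isum := integrableD measurableT i1 i2.
(* [fine] sends an infinite integral to 0, so the comparison needs an integrable energy density; the
   maximum of [c j] supplies it, the minimum being the coercivity constant. *)
have icw : lebesgue_measure.-integrable `]0%R, 1%R[
    (EFin \o (fun x => (mu j)%:num * c j x * (complex.Re (w x) * complex.Re (w x) +
      complex.Im (w x) * complex.Im (w x)))).
  have isum' := integrable_leb01 (integrableZl measurableT ((mu j)%:num * c j y0) isum).
  apply: (le_integrable _ _ _ isum') => //.
    apply/measurable_EFinP; apply: measurable_funM.
      apply: measurable_funM => //.
      have mc : measurable_fun `[0 : R, 1]%classic (c j).
        by apply: subspace_continuous_measurable_fun.
      apply: measurable_funS mc => //.
      by apply: subset_itv; rewrite bnd_simp.
    apply: measurable_funTS; apply: measurable_funD; apply: measurable_funM;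
      by [exact: measurable_Lfun2 w1|exact: measurable_Lfun2 w2].
  move=> x /=; rewrite in_itv/= => /andP[x_0 x_1].
  have x01' : x \in `[0, 1] by rewrite in_itv/= !ltW.
  have cx : 0 < c j x by apply: cpos; rewrite !ltW.
  rewrite ?lee_fin -!expr2.
  have S0 : 0 <= complex.Re (w x) ^+ 2 + complex.Im (w x) ^+ 2.
    by rewrite addr_ge0// sqr_ge0.
  have A0 : 0 <= (mu j)%:num * c j x by rewrite mulr_ge0// ltW.
  have B0 : 0 <= (mu j)%:num * c j y0 by rewrite (le_trans A0)// ler_wpM2l// ymax.
  rewrite [leLHS]ger0_norm ?[leRHS]ger0_norm ?(mulr_ge0 A0 S0) ?(mulr_ge0 B0 S0)//.
  by rewrite ler_wpM2r// ler_wpM2l// ymax.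
apply: fine_le.
- exact: integrable_fin_num (integrable_leb01 ikb).
- exact: integrable_fin_num icw.
apply: le_integral => //; first exact: integrable_leb01 ikb.
move=> x; rewrite inE/= in_itv/= => /andP[x_0 x_1].
have x01' : x \in `[0, 1] by rewrite in_itv/= !ltW.
have cx := xmin _ x01'.
rewrite lee_fin -!expr2; apply: ler_pM.
- by rewrite mulr_ge0// ltW.
- exact: sqr_ge0.
- by rewrite ler_wpM2l.
- by case: b {ib ikb}; rewrite /= ?lerDl ?lerDr sqr_ge0.
Qed.

End form.

(** * From energy bounds to essential bounds *)

Section smoothing.
Context {R : realType} {n m : nat}.
Variables (src tgt : 'I_m -> 'I_n) (mu : 'I_m -> {posnum R}) (c : 'I_m -> R -> R).
Hypothesis cC1 : forall j, C1_01 (c j).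
Hypothesis cpos : forall j x, 0 <= x <= 1 -> 0 < c j x.
Variable T : R -> ('I_m -> R -> R[i]) -> ('I_m -> R -> R[i]).
Hypothesis TA : semigroup_generated_by_A src tgt mu c T.

Local Notation nu j := (weighted_leb01 (mu j)).
Local Notation X2 := (X2 mu).
Local Notation sip := (@X2_sip R m mu).
Local Notation N := (seminorm sip).
Local Notation Tt := (sgT T).
Local Notation gen := (sg_generator sip (@sgT _ _ mu T)).
Let sipP := X2_semi_inner_product mu.
Let Tsg := sgT_semigroup TA.
Let compl := @X2_complete _ _ mu.

Lemma sg_generator_sym (f1 g1 f2 g2 : X2) : gen f1 g1 -> gen f2 g2 ->
  sip g1 f2 = sip g2 f1.
Proof.
move=> /(sg_generator_form TA)[V1 H1] /(sg_generator_form TA)[V2 H2].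
apply: oppr_inj; apply: (etrans (esym (H1 _ V2))); apply: (etrans _ (H2 _ V1)).
exact: Re_form_a_sym.
Qed.

Lemma sg_generator_le0 (f g : X2) : gen f g -> sip g f <= 0.
Proof.
move=> /(sg_generator_form TA)[V1 H1].
by rewrite -oppr_ge0 -(H1 _ V1) Re_form_a_ge0.
Qed.

Lemma ae_leb01_weighted j (P : R -> Prop) :
  {ae leb01, forall x, P x} -> {ae nu j, forall x, P x}.
Proof.
move=> [E [mE E0 HE]]; exists E; split => //.
have -> : nu j E = (((mu j)%:num)%:E * leb01 E)%E by [].
by rewrite E0 mule0.
Qed.

(** Makes constants uniform over the edges: the sum of inverses dominates each inverse, and the
    added 1 gives [L <= L ^+ 2], used to complete squares. *)
Lemma sum_bound (F : 'I_m -> R) : (forall j, 0 < F j) ->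
  exists2 L, 1 <= L & forall j, 1 <= L * F j.
Proof.
move=> F0; exists (1 + \sum_j (F j)^-1) => [|j].
  by rewrite lerDl sumr_ge0// => j _; rewrite invr_ge0 ltW.
rewrite -ler_pdivrMr// div1r (bigD1 j)//= addrCA lerDl addr_ge0// sumr_ge0// => k _.
by rewrite invr_ge0 ltW.
Qed.

(** The energy inequality bounds both [N u ^+ 2] and [t * a(u, u)] by [N f ^+ 2]. [L] removes the
    weights [mu j] and [K] the coercivity constants, so interpolation applies at length [s ^+ 2]. *)
Lemma sg_domain_bound : exists2 C, 0 < C & forall (f g : X2) t s e j b, gen f g ->
  0 < t -> 0 < s <= 1 -> s ^+ 4 <= t -> 0 < e ->
  {ae nu j, forall x, `|part b (Tt t f j x)| <= C * (N f + e) / s}.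
Proof.
have mu0 j : 0 < (mu j)%:num by [].
have [L L1 HL] := sum_bound mu0.
have coer j : exists k, 0 < k /\ forall f b, form_domain src tgt f ->
    k * (\int[leb01]_x (part b (wderiv (f j) x) ^+ 2))%R <= complex.Re (form_a mu c f f).
  by have [k k0 Hk] := @form_coercive R n m src tgt mu c cC1 cpos j; exists k.
have [k Hk] := choice coer.
have [K K1 HK] := sum_bound (fun j => proj1 (Hk j)).
have L0 : 0 < L by lra.
have K0 : 0 < K by lra.
exists ((8 + K) * L) => [|f g t s e j b fg t0 s01 st e0].
  by rewrite mulr_gt0//; lra.
have [k0 {}Hk] := Hk j.
set u := Tt t f; set v := Tt t g.
have uv : gen u v by apply: (sg_generator_orbit sipP compl Tsg) => //; exact: ltW.
have [uV uform] := sg_generator_form TA uv.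
have vu0 := sg_generator_le0 uv.
have en := sg_energy sipP compl Tsg sg_generator_sym fg (ltW t0).
rewrite -/u -/v in en.
have Nf0 := seminorm_ge0 sip f.
have Nuf : N u ^+ 2 <= N f ^+ 2.
  by apply: le_trans en; rewrite lerBrDr gerDl pmulr_rle0// mulr_gt0.
set E := - sip v u; have EE : complex.Re (form_a mu c u u) = E by exact: uform.
have E0 : 0 <= E by rewrite oppr_ge0.
have tE : t * E <= N f ^+ 2.
  have : 0 <= N u ^+ 2 by rewrite sqr_ge0.
  have : 0 <= t * E by rewrite mulr_ge0// ltW.
  by move: en; rewrite /E; lra.
have s0 : 0 < s by case/andP: s01.
(* Adding [e] keeps [a] positive when [N f = 0], as interpolation divides by it. *)
pose a := L * (N f + e).
have a0 : 0 < a by rewrite mulr_gt0//; lra.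
have [_ [w1 w2] uw] : [/\ True, cLfun leb01 2%:E (wderiv (u j)) &
    weak_derivative (u j) (wderiv (u j))].
  by have [] := wderivP (uV.1 j).
have [[u1 u2] _] := uV.1 j.
have ub2 : (fun x => part b (u j x)) \in Lfun leb01 2%:E by case: (b).
have wb2 : (fun x => part b (wderiv (u j) x)) \in Lfun leb01 2%:E by case: (b).
have -> : (8 + K) * L * (N f + e) / s = (8 + K) * a / s by rewrite /a mulrA.
apply: ae_leb01_weighted.
apply: (sobolev_interpolation ub2 wb2 _ a0 K0 s01).
- by move=> phi tphi; exact: weak_derivative_part.
- have mb := measurable_Lfun2 ub2.
  have := integral_part_le b u j; rewrite integral_weighted; last 2 first.
  + by apply/measurable_EFinP/measurable_funX.
  + by move=> x; rewrite lee_fin sqr_ge0.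
  rewrite -(fineK (integrable_fin_num measurableT (Lfun2_integrable_sqr ub2))).
  rewrite -EFinM lee_fin -/(Rintegral _ _ _); set I := Rintegral _ _ _ => HI.
  have I0 : 0 <= I by rewrite Rintegral_ge0// => x _; exact: sqr_ge0.
  have h1 : I <= L * (mu j)%:num * I by rewrite ler_peMl.
  have h2 : L * ((mu j)%:num * I) <= L * N f ^+ 2.
    by rewrite ler_wpM2l ?(ltW L0)// (le_trans HI).
  have h3 : L * N f ^+ 2 <= L ^+ 2 * N f ^+ 2.
    by rewrite ler_wpM2r ?sqr_ge0// expr2 ler_peMl// ltW.
  have h4 : L ^+ 2 * N f ^+ 2 <= a ^+ 2.
    rewrite /a exprMn ler_wpM2l ?sqr_ge0// lerXn2r ?nnegrE//; lra.
  by rewrite -mulrA in h1; exact: le_trans (le_trans h1 h2) (le_trans h3 h4).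
- have := Hk u b uV; rewrite EE; set I := Rintegral _ _ _ => HI.
  have I0 : 0 <= I by rewrite Rintegral_ge0// => x _; exact: sqr_ge0.
  have h1 : I <= K * k j * I by rewrite ler_peMl.
  have h2 : K * (k j * I) <= K * E by rewrite ler_wpM2l// ltW.
  have s4 : 0 < s ^+ 4 by rewrite exprn_gt0.
  have h3 : s ^+ 4 * E <= N f ^+ 2 by rewrite (le_trans _ tE)// ler_wpM2r.
  have h4 : N f ^+ 2 <= a ^+ 2.
    rewrite lerXn2r ?nnegrE ?(ltW a0)// /a (le_trans (_ : _ <= 1 * (N f + e)))//; first lra.
    by rewrite ler_wpM2r//; lra.
  have h5 : K * E <= K * (a ^+ 2 / s ^+ 4).
    by rewrite ler_wpM2l ?(ltW K0)// ler_pdivlMr// mulrC (le_trans h3).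
  have h6 : K * (a ^+ 2 / s ^+ 4) <= K ^+ 2 * (a ^+ 2 / s ^+ 4).
    rewrite ler_wpM2r ?divr_ge0 ?sqr_ge0 ?(ltW s4)//.
    by rewrite expr2 ler_peMl// ltW.
  rewrite -mulrA in h1; apply: (le_trans (le_trans h1 h2)); apply: (le_trans h5).
  by apply: (le_trans h6); rewrite le_eqVlt; apply/orP; left; apply/eqP; field; rewrite gt_eqF.
Qed.

(** The squared excess over [M] is stable under L^2 approximation, so an essential bound passes to
    the limit without an almost everywhere convergent subsequence. *)
Lemma ae_le_of_integral_pos_part d (S : measurableType d) (w : {measure set S -> \bar R})
    (p : S -> R) (M : R) : measurable_fun setT p ->
  (forall e, 0 < e -> (\int[w]_x ((Num.max 0 (`|p x| - M)) ^+ 2)%:E <= e%:E)%E) ->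
  {ae w, forall x, `|p x| <= M}.
Proof.
move=> mp Hp; pose q x := ((Num.max 0 (`|p x| - M)) ^+ 2)%:E.
have q0 x : (0 <= q x)%E by rewrite lee_fin sqr_ge0.
have mq : measurable_fun setT q.
  apply/measurable_EFinP/measurable_funX; apply: measurable_maxr => //.
  by apply: measurable_funB => //; exact: measurableT_comp.
have /(ae_eq_integral_abs w measurableT mq) [E [mE E0 HE]] : (\int[w]_x `|q x| = 0)%E.
  apply/eqP; rewrite eq_le integral_ge0// andbT.
  apply/lee_addgt0Pr => e e0; rewrite add0e.
  by under eq_integral do rewrite gee0_abs//; exact: Hp.
exists E; split => // x /= /negP; rewrite -ltNge => Mx; apply: HE => /= /(_ Logic.I).
rewrite /q => -[] /eqP; rewrite sqrf_eq0; apply/negP.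
by rewrite max_r ?gt_eqF ?subr_gt0// subr_ge0 ltW.
Qed.

Lemma sg_bound : exists2 C, 0 < C & forall (f : X2) t s e j b,
  0 < t -> 0 < s <= 1 -> s ^+ 4 <= t -> 0 < e ->
  {ae nu j, forall x, `|part b (Tt t f j x)| <= C * N f / s + e}.
Proof.
have [C C0 HC] := sg_domain_bound; exists C => // f t s e j b t0 s01 st e0.
have s0 : 0 < s by case/andP: s01.
have [B B0 HB] := sg_bounded_upto sipP compl Tsg t.
apply: ae_le_of_integral_pos_part; first exact: measurable_Lfun2 (Lfun_part b (Tt t f) j).
move=> e1 e10.
(* The entry with [C] keeps [2 * C * r / s] below [e]; the other two give
   [(B * r) ^+ 2 <= B ^+ 2 * r <= e1]. *)
pose r := Num.min 1 (Num.min (e * s / (2 * C)) (e1 / (B ^+ 2 + 1))).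
have B2 : 0 < B ^+ 2 + 1 by rewrite ltr_wpDl// sqr_ge0.
have r0 : 0 < r.
  by rewrite !lt_min ltr01/= !divr_gt0// ?mulr_gt0.
have r1 : r <= 1 by rewrite ge_min lexx.
have r2 : r <= e * s / (2 * C) by rewrite !ge_min lexx orbT.
have r3 : r <= e1 / (B ^+ 2 + 1) by rewrite !ge_min lexx !orbT.
have [v [g [vg vf]]] := sg_generator_dense sipP compl Tsg f r0.
have Nv : N v <= N f + r.
  by rewrite -[v](subrK f) addrC (le_trans (seminormD sipP _ _))// lerD2l.
have vb := HC v g t s r j b vg t0 s01 st r0.
have bound : C * (N v + r) / s <= C * N f / s + e.
  have b1 : 2 * C * r <= e * s by rewrite mulrC -ler_pdivlMr// mulr_gt0.
  have b2 : C * N v <= C * (N f + r) by rewrite ler_wpM2l// ltW.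
  rewrite ler_pdivrMr// mulrDl divfK ?gt_eqF//; lra.
have t0' : 0 <= t by exact: ltW.
have mf := measurable_Lfun2 (Lfun_part b (Tt t f) j).
have md := measurable_Lfun2 (Lfun_part b (Tt t f - Tt t v) j).
(* Where [T t v] obeys the bound, the excess of [T t f] is at most the difference of the two
   orbits. *)
apply: (@le_trans _ _ (\int[nu j]_x (part b ((Tt t f - Tt t v) j x) ^+ 2)%:E)%E).
  apply: ae_ge0_le_integral => //.
  - by move=> x _; rewrite lee_fin sqr_ge0.
  - apply/measurable_EFinP/measurable_funX; apply: measurable_maxr => //.
    by apply: measurable_funB => //; exact: measurableT_comp.
  - by move=> x _; rewrite lee_fin sqr_ge0.
  - by apply/measurable_EFinP/measurable_funX.
  have [E [mE E0 HE]] := vb; exists E; split => // x /= Hx; apply: HE => /= Hv; apply: Hx => _.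
  rewrite lee_fin -[leRHS]/(part b ((Tt t f j x : R[i]) - (Tt t v j x : R[i])) ^+ 2) partB.
  rewrite -[leRHS]real_normK ?num_real// lerXn2r ?nnegrE//; first by rewrite le_max lexx.
  rewrite ge_max normr_ge0/= lerBlDr.
  rewrite -[part b (Tt t f j x)](subrK (part b (Tt t v j x))) (le_trans (ler_normD _ _))//.
  by rewrite subrK lerD2l (le_trans Hv).
apply: (le_trans (integral_part_le b (Tt t f - Tt t v) j)); rewrite lee_fin.
have <- : N (Tt t (f - v)) = N (Tt t f - Tt t v) by exact: (seminorm_sgB sipP Tsg).
apply: (@le_trans _ _ ((B * r) ^+ 2)).
  rewrite lerXn2r ?nnegrE ?seminorm_ge0 ?mulr_ge0 ?(ltW r0)//.
  apply: (le_trans (HB _ _ _)); first by rewrite t0' lexx.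
  by rewrite ler_wpM2l// (seminormC sipP).
have h1 : r * (B ^+ 2 + 1) <= e1 by rewrite -ler_pdivlMr.
have h2 : r * r <= r * 1 by rewrite ler_wpM2l// ltW.
have h3 : B ^+ 2 * (r * r) <= B ^+ 2 * r by rewrite ler_wpM2l ?sqr_ge0// -[leRHS]mulr1.
rewrite exprMn [r ^+ 2]expr2 (le_trans h3)//; lra.
Qed.

Lemma Re_normc_le (z : R[i]) : complex.Re `|z| <= `|complex.Re z| + `|complex.Im z|.
Proof.
rewrite normc_def /= -[leRHS]ger0_norm ?addr_ge0// -sqrtr_sqr ler_wsqrtr//.
rewrite -(real_normK (num_real (complex.Re z))) -(real_normK (num_real (complex.Im z))).
have := mulr_ge0 (normr_ge0 (complex.Re z)) (normr_ge0 (complex.Im z)); nra.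
Qed.

Lemma Lnorm_oo_le j (p : R -> R) (M : R) : 0 <= M ->
  {ae nu j, forall x, `|p x| <= M} -> (Lnorm (nu j) +oo%E (EFin \o p) <= M%:E)%E.
Proof.
move=> M0 pM; rewrite unlock /Lnorm; case: ifPn => _; last by rewrite lee_fin.
exact/ess_supP.
Qed.

Lemma ultracontractive_bound : exists2 C, 0 < C & forall f t s,
  in_X mu 2%:E f -> 0 < t -> 0 < s <= 1 -> s ^+ 4 <= t ->
  in_X mu +oo%E (T t f) /\ (Xoo_norm mu (T t f) <= (C / s * X2_norm mu f)%:E)%E.
Proof.
have [C C0 HC] := sg_bound; exists (2 * C); first by rewrite mulr_gt0.
move=> f t s fX t0 s01 st; pose F : X2 := MkX2 (asboolT fX : X2_pred mu f).
have TE : Tt t F = T t f :> (_ -> _ -> _) by rewrite (sgTE TA)// ltW.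
have s0 : 0 < s by case/andP: s01.
have M0 e : 0 < e -> 0 <= C * N F / s + e.
  by move=> /ltW e0; rewrite addr_ge0// divr_ge0 ?(ltW s0)// mulr_ge0 ?(ltW C0)// seminorm_ge0.
split.
  move=> j; rewrite -TE.
  have part_oo b : (fun x => part b (Tt t F j x)) \in Lfun (nu j) +oo%E.
    rewrite inE; apply/andP; split; rewrite inE//=.
      exact: measurable_Lfun2 (Lfun_part b (Tt t F) j).
    have := HC F t s 1 j b t0 s01 st ltr01.
    move=> /(Lnorm_oo_le (M0 _ ltr01)) /le_lt_trans; apply; exact: ltry.
  by split; [exact: (part_oo true)|exact: (part_oo false)].
rewrite -TE; apply/lee_addgt0Pr => e e0.
have e4 : 0 < e / 2 by rewrite divr_gt0.
have bnd : (2 * C / s * X2_norm mu f)%:E + e%:E =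
    ((C * N F / s + e / 2) + (C * N F / s + e / 2))%:E :> \bar R.
  by rewrite -EFinD; congr EFin; rewrite -[X2_norm mu f]/(N F); field; rewrite gt_eqF.
rewrite bnd; apply: bigmax_le => [|j _]; first by rewrite lee_fin addr_ge0// M0.
apply: Lnorm_oo_le; first by rewrite addr_ge0// M0.
have [E1 [mE1 E10 HE1]] := HC F t s (e / 2) j true t0 s01 st e4.
have [E2 [mE2 E20 HE2]] := HC F t s (e / 2) j false t0 s01 st e4.
exists (E1 `|` E2); split; first exact: measurableU.
  exact: (etrans (measureU0 mE1 mE2 E20) E10).
move=> x /= Hx; apply: contrapT => /not_orP[xE1 xE2]; apply: Hx.
have h1 : `|complex.Re (Tt t F j x)| <= C * N F / s + e / 2.
  by apply: contrapT => H; apply: xE1; exact: HE1.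
have h2 : `|complex.Im (Tt t F j x)| <= C * N F / s + e / 2.
  by apply: contrapT => H; apply: xE2; exact: HE2.
have Re0 (z : R[i]) : `|complex.Re (`|z|)| = complex.Re `|z|.
  by rewrite ger0_norm// normc_def /= sqrtr_ge0.
apply: (le_trans _ (lerD h1 h2)); apply: le_trans (Re_normc_le _).
by rewrite -Re0.
Qed.

End smoothing.

Theorem lemma3p2 (R : realType) (n m : nat) (src tgt : 'I_m -> 'I_n)
    (mu : 'I_m -> {posnum R}) (c : 'I_m -> R -> R)
    (T2 : R -> ('I_m -> R -> R[i]) -> ('I_m -> R -> R[i]))
    (Gsimple : simple_graph src tgt)
    (Gconnected : connected_graph src tgt)
    (Gdegree : forall v, (2 <= degree src tgt v)%N)
    (cC1 : forall j, C1_01 (c j))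
    (cpos : forall j x, 0 <= x <= 1 -> 0 < c j x)
    (T2A : semigroup_generated_by_A src tgt mu c T2) :
  ultracontractive mu T2 /\
  exists M : R, forall t f, 0 < t <= 1 -> in_X mu 2%:E f ->
    (Xoo_norm mu (T2 t f) <= (M * t `^ (- 4^-1) * X2_norm mu f)%:E)%E.
Proof.
have [C C0 HC] := ultracontractive_bound cC1 cpos T2A; split.
  (* Any admissible [s] gives boundedness at time [t]; here [s ^+ 4 <= s <= t] because [s <= 1]. *)
  move=> t t0; pose s := Num.min 1 t.
  have s0 : 0 < s by rewrite lt_min ltr01.
  have s1 : s <= 1 by rewrite ge_min lexx.
  have s01 : 0 < s <= 1 by rewrite s0.
  exists (C / s) => f fX; apply: HC => //.
  rewrite (le_trans (_ : _ <= s)) ?ge_min ?lexx ?orbT//.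
  by rewrite exprS ler_piMr ?(ltW s0)// exprn_ile1// ltW.
exists C => t f /andP[t0 t1] fX.
(* The largest scale with [s ^+ 4 <= t] is the fourth root of [t], and [C / s] is then the stated
   rate. *)
have s0 : 0 < t `^ 4^-1 by rewrite powR_gt0.
have s4 : (t `^ 4^-1) ^+ 4 = t.
  by rewrite -powR_mulrn ?powR_ge0// -powRrM mulVf// powRr1// ltW.
have s1 : t `^ 4^-1 <= 1.
  by rewrite -(@ler_pXn2r _ 4)// ?nnegrE ?(ltW s0)// s4 expr1n.
rewrite powRN; apply: (HC f t _ fX t0 _ _).2; first by rewrite s0.
by rewrite s4.
Qed.
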